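(* Let $n=2m$, $m=2m_1$, with $m_1\equiv 1\pmod 2$ and $m_1\geq 3$, and let $a\in\mathbb{F}_{2^m}$, $a\ne 0$. Let $b$ be a primitive element of $\mathbb{F}_{16}$ (a generator of $\mathbb{F}_{16}^*$) such that $\mathrm{Tr}_1^4(b)=0$. The Boolean function $f_{a,b}:\mathbb{F}_{2^n}\to\mathbb{F}_2$, $$f_{a,b}(x)=\mathrm{Tr}_1^n(ax^{2^m-1})+\mathrm{Tr}_1^4(bx^{\frac{2^n-1}{5}}),$$ is a hyper-bent function if and only if one of the assertions (1) and (2) holds. (1) $p(x)=x^5+x+a^{-1}$ has factorization type $(1)(2)^2$ over $\mathbb{F}_{2^m}$, and $K_m(a)=-4$. (2) $p(x)=x^5+x+a^{-1}$ is irreducible over $\mathbb{F}_{2^m}$, the quadratic form $\mathfrak{q}(x)=\mathrm{Tr}_1^m(x(ax^4+ax^2+a^2x))$ over $\mathbb{F}_{2^m}$ is even, and $K_m(a)=2\cdot 2^{m_1}-4$.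
   Context: $\mathrm{Tr}_1^k:\mathbb{F}_{2^k}\to\mathbb{F}_2$ is the absolute trace; $\mathbb{F}_{16}\subset\mathbb{F}_{2^n}$ since $4\mid n$. For $t\in\mathbb{F}_2$ put $\chi(t)=(-1)^t$. A Boolean function $f:\mathbb{F}_{2^n}\to\mathbb{F}_2$ is bent if $\sum_{x\in\mathbb{F}_{2^n}}\chi(f(x)+\mathrm{Tr}_1^n(wx))=\pm 2^{n/2}$ for all $w\in\mathbb{F}_{2^n}$; it is hyper-bent if it is bent and, for every integer $i$ with $\gcd(i,2^n-1)=1$, $x\mapsto f(x^i)$ is also bent. The Kloosterman sum is $K_m(a)=\sum_{x\in\mathbb{F}_{2^m}}\chi(\mathrm{Tr}_1^m(ax+\frac1x))$, with the convention $\frac10=0$. A polynomial has factorization type $(n_1)^{r_1}(n_2)^{r_2}\cdots(n_t)^{r_t}$ if exactly $r_i$ of its irreducible factors have degree $n_i$; thus $(1)(2)^2$ means one linear factor and two irreducible quadratic factors. Parity of $\mathfrak{q}$: $\mathfrak{q}$ is the $\mathbb{F}_2$-valued quadratic form on the $\mathbb{F}_2$-space $\mathbb{F}_{2^m}$ associated with the symplectic form $\langle x,y\rangle_{\mathfrak q}=\mathrm{Tr}_1^m(x(ay^4+ay^2+a^2y)+y(ax^4+ax^2+a^2x))$, which is non-degenerate when $x^5+x+a^{-1}$ is irreducible over $\mathbb{F}_{2^m}$. In that case take a symplectic basis $e_1,\dots,e_{2m_1}$ of $\mathbb{F}_{2^m}$ ($2m_1=m$), i.e. $\langle e_i,e_j\rangle_{\mathfrak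 q}=0$ if $i\not\equiv j\pmod{m_1}$ and $\langle e_i,e_{m_1+i}\rangle_{\mathfrak q}=1$ for $1\le i\le m_1$. The form $\mathfrak q$ is called even if $\#\{i\mid 1\le i\le m_1,\ \mathfrak q(e_i)=\mathfrak q(e_{m_1+i})=1\}$ is even, and odd otherwise. *)

(* Defs.v *)
From HB Require Import structures.
From mathcomp Require Import all_boot all_order all_algebra all_fingroup.
From mathcomp Require Import all_solvable all_field.

Set Implicit Arguments.
Unset Strict Implicit.
Unset Printing Implicit Defensive.

Import Order.TTheory GRing.Theory Num.Theory.
Local Open Scope ring_scope.

(* Absolute trace Tr_1^k of F_(2^k), evaluated on elements of any field F      *)
(* containing F_(2^k).  On F_(2^k), i.e. when x ^+ (2 ^ k) = x, the sum lies   *)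
(* in the prime field {0, 1} of F, which is identified here with 'F_2 (see     *)
(* trace2E).  Only such arguments x are meaningful.                            *)
Definition trace2 (F : fieldType) (k : nat) (x : F) : 'F_2 :=
  if \sum_(i < k) x ^+ (2 ^ i) == 0 then 0 else 1.

Lemma trace2E (F : fieldType) (k : nat) (x : F) :
  2%N \in [pchar F] -> x ^+ (2 ^ k) = x ->
  \sum_(i < k) x ^+ (2 ^ i) = (trace2 k x : nat)%:R.
Proof.
move=> ch2 xk; rewrite /trace2; set s := \sum_(i < k) _.
have s2 : s ^+ 2 = s.
  rewrite -(pFrobenius_autE ch2) rmorph_sum /=.
  under eq_bigr => i _ do rewrite pFrobenius_autE -exprM -expnSr.
  apply: (addrI x); transitivity (\sum_(i < k.+1) x ^+ (2 ^ i)).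
    by rewrite big_ord_recl expn0 expr1.
  by rewrite big_ord_recr /= xk addrC.
case: eqP => [-> //|/eqP s0].
by apply: (mulfI s0); rewrite -expr2 s2 mulr1.
Qed.

Definition chi (t : 'F_2) : int := (-1) ^+ t.

(* F is meant to have 2 ^ n elements, with n even. *)
Definition bent (n : nat) (F : finFieldType) (f : F -> 'F_2) : Prop :=
  forall w : F,
    let W := \sum_(x : F) chi (f x + trace2 n (w * x)) in
    W = 2 ^+ n./2 \/ W = - 2 ^+ n./2.

(* The exponent i ranges over all integers; 0 ^ i = 0 for i != 0. *)
Definition hyper_bent (n : nat) (F : finFieldType) (f : F -> 'F_2) : Prop :=
  bent n f /\
  forall i : int, coprimez i (2 ^+ n - 1) -> bent n (fun x => f (x ^ i)).

(* The inverse of 0 is 0. *)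
Definition Kloosterman (m : nat) (F : finFieldType) (a : F) : int :=
  \sum_(x : F) chi (trace2 m (a * x + x^-1)).

(* nr lists the pairs (n_i, r_i) of the type (n_1)^(r_1) ... (n_t)^(r_t), so   *)
(* tally_seq nr is the multiset of the degrees of the irreducible factors.     *)
Definition factorization_type (F : fieldType) (nr : seq (nat * nat))
    (p : {poly F}) : Prop :=
  exists qs : seq {poly F},
    [/\ forall q, q \in qs -> irreducible_poly q,
        p %= \prod_(q <- qs) q
      & perm_eq [seq (size q).-1 | q : {poly F} <- qs] (tally_seq nr)].

Definition F2_basis (F : finFieldType) (d : nat) (e : 'I_d -> F) : Prop :=
  forall x : F, exists! c : {ffun 'I_d -> 'F_2}, x = \sum_(i < d) e i *+ c i.

(* Basis vectors are numbered from 0: the partner of e_i is e_(d + i). *)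
Definition symplectic_basis (F : finFieldType) (B : F -> F -> 'F_2) (d : nat)
    (e : 'I_(d + d) -> F) : Prop :=
  [/\ F2_basis e,
      forall i j : 'I_(d + d), i != j %[mod d] -> B (e i) (e j) = 0
    & forall i : 'I_d, B (e (lshift d i)) (e (rshift d i)) = 1].

(* Parity of a quadratic form q with associated symplectic form B, in          *)
(* dimension 2 * d.  When B is non-degenerate, symplectic bases exist and the  *)
(* parity of the count is the same for all of them (Arf invariant).            *)
Definition even_form (F : finFieldType) (B : F -> F -> 'F_2) (q : F -> 'F_2)
    (d : nat) : Prop :=
  exists e : 'I_(d + d) -> F,
    symplectic_basis B e /\
    ~~ odd #|[set i : 'I_d | (q (e (lshift d i)) == 1)
                             && (q (e (rshift d i)) == 1)]|.

Definition sform (m : nat) (F : fieldType) (a x y : F) : 'F_2 :=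
  trace2 m (x * (a * y ^+ 4 + a * y ^+ 2 + a ^+ 2 * y)
            + y * (a * x ^+ 4 + a * x ^+ 2 + a ^+ 2 * x)).

Definition qform (m : nat) (F : fieldType) (a x : F) : 'F_2 :=
  trace2 m (x * (a * x ^+ 4 + a * x ^+ 2 + a ^+ 2 * x)).

(* f_(a,b) on F_(2^n), n = 2m, with a and b given as elements of F_(2^n). *)
Definition fab (m n : nat) (F : fieldType) (a b : F) (x : F) : 'F_2 :=
  trace2 n (a * x ^+ (2 ^ m - 1)) + trace2 4 (b * x ^+ ((2 ^ n - 1) %/ 5)).

(* Main.v *)
(* Let |K| = s^2, s = 2^m1, and let U be the group of (s^2 + 1)-st roots of
   unity in L.  As f is constant on the sets K^* x, it is hyper-bent iff the sum
   over v in U of chi(Tr(a v) + Tr(b v^((s^2+1)/5))) is 1.  Adding the terms of v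
   and 1/v kills those with v^((s^2+1)/5) <> 1, so five times this sum is the
   sum over U of chi(Tr(a v^5)).  Since v^5 + v^-5 = D(v + 1/v) for the Dickson
   polynomial D(t) = t^5 + t^3 + t, and Tr(a D(t)) = q(t) on K, comparing U with
   K^* (on which c -> c^5 is a bijection) turns the condition into
   K_m(a) = 2 Q - 4, where Q is the sum of chi(q(t)) over K.

   Q^2 is s^2 times the sum of chi(q(z)) over the radical of q.  The nonzero
   elements of the radical are the roots of p in K, where q vanishes, and the
   sums of two roots of p that lie in K, where q tells whether the corresponding
   quadratic factor of p is irreducible.  So Q = 0 for the type (1)(2)^2, while
   Q = s or Q = - s, according to the Arf invariant, if p is irreducible, and
   |Q| >= 2 s otherwise.

   All the cases not listed in the theorem contradict |K_m(a) - 1| <= 2 s.  This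
   is proved as in Manin's proof of the Hasse bound: on a twist over K(X) of the
   curve y^2 + x y = x^3 + a^2, the heights of Frobenius + n P, for P of abscissa
   X, are a quadratic polynomial n^2 -+ (K_m(a) - 1) n + s^2 in n, hence this is
   nonnegative.  Abscissas suffice for this, so no group law is needed. *)

Require Import Defs.
From HB Require Import structures.
From mathcomp Require Import all_boot all_order all_algebra all_fingroup.
From mathcomp Require Import all_solvable all_field.
From mathcomp Require Import zify ring.

Set Implicit Arguments.
Unset Strict Implicit.
Unset Printing Implicit Defensive.

Import Order.TTheory GRing.Theory Num.Theory.
Local Open Scope ring_scope.

(** * Traces and characters of finite fields of characteristic 2 *)

Lemma chiD (s t : 'F_2) : chi (s + t) = chi s * chi t.
Proof. by case: s => [[|[|//]] ?]; case: t => [[|[|//]] ?]. Qed.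

Lemma chi0 : chi 0 = 1. Proof. by []. Qed.

Lemma chi1 : chi 1 = -1. Proof. by []. Qed.

Lemma F2P (t : 'F_2) : t = 0 \/ t = 1.
Proof.
case: t => [[|[|//]] ?]; [left | right]; exact/val_inj.
Qed.

Lemma addFF (t : 'F_2) : t + t = 0.
Proof. by case: (F2P t) => ->; apply/val_inj. Qed.

Lemma sum_chi_involution (I : finType) (A : {pred I}) (F : I -> 'F_2) (s : I -> I) :
  involutive s -> (forall x, x \in A -> s x \in A) ->
  (forall x, x \in A -> F (s x) = F x + 1) -> \sum_(x in A) chi (F x) = 0.
Proof.
move=> sK As Fs; set S := \sum_(x in A) _.
have : S = - S.
  rewrite {1}/S (reindex_inj (inv_inj sK)) /= -sumrN.
  apply: eq_big => [x|x]; first by apply/idP/idP => /As; rewrite ?sK.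
  by move/As; rewrite sK => /Fs ->; rewrite chiD chi1 mulrN1.
by lia.
Qed.

Section Char2.
Variables (F : finFieldType) (k : nat).
Hypothesis cardF : #|F| = (2 ^ k)%N.

Lemma card2_pchar : 2%N \in [pchar F].
Proof. exact: card_finPcharP cardF _. Qed.

Lemma card2_natr2 : 2%:R = 0 :> F.
Proof. exact: (pcharf0 card2_pchar). Qed.

Lemma addxx2 (x : F) : x + x = 0.
Proof. exact: (addrr_pchar2 card2_pchar). Qed.

Lemma oppr2 (x : F) : - x = x.
Proof. exact: (oppr_pchar2 card2_pchar). Qed.

Lemma expf_cardk (x : F) : x ^+ (2 ^ k) = x.
Proof. by rewrite -cardF expf_card. Qed.

Lemma sqrD2 (x y : F) : (x + y) ^+ 2 = x ^+ 2 + y ^+ 2.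
Proof. have h := card2_natr2; ring: h. Qed.

Lemma expD2X (i : nat) (x y : F) : (x + y) ^+ (2 ^ i) = x ^+ (2 ^ i) + y ^+ (2 ^ i).
Proof. by elim: i => [|i IH]; rewrite ?expr1 // !expnSr !exprM IH sqrD2. Qed.

Lemma sqr_inj2 : injective (fun x : F => x ^+ 2).
Proof.
move=> x y /eqP; rewrite -subr_eq0 oppr2 -sqrD2 sqrf_eq0 addr_eq0 oppr2.
by move/eqP.
Qed.

Lemma sqr_surj2 (x : F) : exists y, x = y ^+ 2.
Proof.
case: (injF_bij sqr_inj2) => g _ gK.
by exists (g x); rewrite gK.
Qed.

Lemma natF2_inj (s t : 'F_2) : (s : nat)%:R = (t : nat)%:R :> F -> s = t.
Proof.
by case: (F2P s) => ->; case: (F2P t) => -> //= /eqP; rewrite ?(eq_sym 0) (oner_eq0 F).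
Qed.

Lemma natF2D (s t : 'F_2) : (nat_of_ord (s + t)%R)%:R = (s : nat)%:R + (t : nat)%:R :> F.
Proof. by case: (F2P s) => ->; case: (F2P t) => -> /=; rewrite ?addr0 ?add0r ?addxx2. Qed.

Notation tr := (@trace2 F k).

Lemma trE (x : F) : (tr x : nat)%:R = \sum_(i < k) x ^+ (2 ^ i).
Proof. by rewrite (trace2E card2_pchar (expf_cardk x)). Qed.

Lemma trD (x y : F) : tr (x + y) = tr x + tr y.
Proof.
apply: natF2_inj; rewrite natF2D !trE -big_split /=.
by apply: eq_bigr => i _; rewrite expD2X.
Qed.

Lemma tr0 : tr 0 = 0.
Proof. by rewrite -[0 in LHS]addr0 trD addFF. Qed.

Lemma tr_sqr (x : F) : tr (x ^+ 2) = tr x.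
Proof.
apply: natF2_inj; rewrite !trE; apply: (addrI x).
transitivity (\sum_(i < k.+1) x ^+ (2 ^ i)).
  by rewrite big_ord_recl expn0 expr1; under eq_bigr => i _ do rewrite -exprM -expnS.
by rewrite big_ord_recr /= expf_cardk addrC.
Qed.

Lemma tr_exp2 (i : nat) (x : F) : tr (x ^+ (2 ^ i)) = tr x.
Proof. by elim: i => [|i IH]; rewrite ?expr1 // expnSr exprM tr_sqr. Qed.

Lemma tr1_even : ~~ odd k -> tr 1 = 0.
Proof.
move=> ek; apply: natF2_inj; rewrite trE; under eq_bigr => i _ do rewrite expr1n.
by rewrite sumr_const card_ord -(odd_double_half k) (negPf ek) -mul2n mulrnA card2_natr2 mul0rn.
Qed.

Hypothesis k_gt0 : (0 < k)%N.

(** The trace is given by a polynomial of degree 2^(k-1), which cannot vanish at all 2^k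
    elements. *)
Lemma tr_surj : exists x, tr x = 1.
Proof.
pose p : {poly F} := \sum_(i < k) 'X^(2 ^ i).
have sp : size p = (2 ^ k.-1).+1.
  rewrite /p -(prednK k_gt0) big_ord_recr /= addrC size_polyDl ?size_polyXn //.
  rewrite ltnS; apply: (leq_trans (size_sum _ _ _)).
  by apply/bigmax_leqP => i _; rewrite size_polyXn ltn_exp2l.
case: (boolP [exists x, tr x == 1]) => [/existsP[x /eqP h]|]; first by exists x.
rewrite negb_exists => /forallP tr_ne1.
have rp : all (root p) (enum F).
  apply/allP => x _; rewrite rootE /p horner_sum.
  under eq_bigr => i _ do rewrite hornerXn.
  by rewrite -trE; move: (tr_ne1 x); case: (F2P (tr x)) => -> /=; rewrite ?eqxx.
have p0 : p != 0 by rewrite -size_poly_eq0 sp.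
have := max_poly_roots p0 rp (enum_uniq _).
rewrite -cardE cardF sp ltnS -{1}(prednK k_gt0) expnS.
by have := expn_gt0 2 k.-1 => /=; lia.
Qed.

(** For w != 0, translation by w^-1 y with tr y = 1 is an involution that changes the sign of every
    term. *)
Lemma sum_chi_tr (w : F) : \sum_(x : F) chi (tr (w * x)) = (2 ^ k * (w == 0))%:Z.
Proof.
case: eqP => [->|/eqP w0].
  under eq_bigr => x _ do rewrite mul0r tr0 chi0.
  by rewrite sumr_const cardT -cardE cardF muln1 natz.
rewrite muln0; have [y ty] := tr_surj.
apply: (@sum_chi_involution _ predT _ (fun x => x + w^-1 * y)) => // x.
  by rewrite -addrA addxx2 addr0.
by move=> _; rewrite mulrDr trD mulrA mulfV // mul1r ty.
Qed.

Lemma card_tr (t : 'F_2) : (#|[set x : F | tr x == t]| * 2 = 2 ^ k)%N.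
Proof.
have [y ty] := tr_surj.
have e : #|[set x : F | tr x == 0%R]| = #|[set x : F | tr x == 1%R]|.
  rewrite -(card_imset _ (addrI y)); apply: eq_card => x; rewrite !inE.
  apply/imsetP/eqP => [[z + ->]|tx]; first by rewrite inE trD ty => /eqP ->; rewrite addr0.
  exists (y + x); last by rewrite addrA addxx2 add0r.
  by rewrite inE trD ty tx addFF.
have : (#|[set x : F | tr x == 0%R]| + #|[set x : F | tr x == 1%R]| = 2 ^ k)%N.
  rewrite -cardF -(cardsC [set x : F | tr x == 0%R]); congr addn.
  by apply: eq_card => x; rewrite !inE; case: (F2P (tr x)) => ->.
by case: (F2P t) => ->; rewrite e; lia.
Qed.

(* The image of z^2 + z is contained in the kernel of the trace and is at least
   as large. *)
Lemma hilbert90 (v : F) : (tr v = 0) <-> (exists z, z ^+ 2 + z = v).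
Proof.
split=> [tv|[z <-]]; last by rewrite trD tr_sqr addFF.
pose A := [set z ^+ 2 + z | z : F].
have sA : A \subset [set x : F | tr x == 0%R].
  by apply/subsetP => _ /imsetP[z _ ->]; rewrite inE trD tr_sqr addFF.
suff /eqP eA : A == [set x : F | tr x == 0%R].
  have : v \in A by rewrite eA inE tv.
  by case/imsetP => z _ ->; exists z.
rewrite eqEcard sA /= -(leq_pmul2r (ltn0Sn 1)) card_tr -cardF.
rewrite -sum1_card (partition_big_imset (fun z : F => z ^+ 2 + z)) /=.
have -> : (#|A| * 2 = \sum_(j in A) 2)%N by rewrite sum_nat_const.
apply: leq_sum => _ /imsetP[z _ ->]; rewrite sum1dep_card.
(* A fibre of z^2 + z has no other elements than z and z + 1. *)
apply: (@leq_trans #|[set z; z + 1]|); last first.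
  by rewrite cards2; case: (_ != _).
apply: subset_leq_card; apply/subsetP => x; rewrite !inE => /eqP h.
have : (x + z) * (x + (z + 1)) = 0.
  have h2 := card2_natr2.
  have -> : (x + z) * (x + (z + 1)) = (x ^+ 2 + x) + (z ^+ 2 + z) + 2 * (x * z) by ring.
  by rewrite h h2 mul0r addr0 addxx2.
by move/eqP; rewrite mulf_eq0 !addr_eq0 !oppr2.
Qed.

End Char2.

(** * Heights of abscissas on y^2 + x y = x^3 + e x^2 + A over F(X) *)

Section Height.
Variables (F : fieldType) (A : F).
Hypotheses (F_char2 : 2%N \in [pchar F]) (A_neq0 : A != 0).
Implicit Types f g : {poly F}.

Let two0 : 2%:R = 0 :> {poly F}.
Proof. by rewrite -polyC_natr (pcharf0 F_char2). Qed.

(* The points of abscissa f/g and f'/g' on the curve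
   y^2 + x y = x^3 + e x^2 + A over F(X) (for any e) differ by a point of
   abscissa X; solving for f'/g' gives the quadratic D z^2 + S z + P = 0. *)
Definition adjacent f g f' g' : Prop :=
  (f * f') ^+ 2 + 'X ^+ 2 * ((f * g') ^+ 2 + (f' * g) ^+ 2)
  + 'X * (f * g * f' * g') + A%:P * (g * g') ^+ 2 = 0.

Let D f g := (f + 'X * g) ^+ 2.
Let S f g := 'X * (f * g).
Let P f g := 'X ^+ 2 * f ^+ 2 + A%:P * g ^+ 2.

Lemma adjacentC f g f' g' : adjacent f g f' g' -> adjacent f' g' f g.
Proof. by rewrite /adjacent => <-; ring. Qed.

Lemma adjacentE f g f' g' :
  adjacent f g f' g' <->
  D f g * f' ^+ 2 + S f g * (f' * g') + P f g * g' ^+ 2 = 0.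
Proof. rewrite /adjacent; split => [<-|<-]; rewrite /D /S /P; ring: two0. Qed.

(** Since f and g are coprime, P shows that d is coprime to f, and D that it is coprime to g. So d
    divides X by S, and then f^2 by D, which leaves only constants. *)
Lemma adjacent_prim f g d : coprimep f g ->
  d %| D f g -> d %| S f g -> d %| P f g -> size d = 1%N.
Proof.
move=> cfg dD dS dP.
have unit_of (e h : {poly F}) : coprimep e h -> e %| h ^+ 2 -> size e = 1%N.
  move=> c e1; apply/eqP; rewrite size_poly_eq1.
  by have /coprimepP := coprimep_expr 2 c; apply.
have cdf : coprimep d f.
  set e := gcdp d f; have [ed ef] : e %| d /\ e %| f by rewrite dvdp_gcdl dvdp_gcdr.
  rewrite /coprimep -/e (unit_of e g) //; first exact: coprimep_dvdr ef cfg.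
  have := dvdp_trans ed dP; rewrite /P dvdp_addr; last first.
    by rewrite dvdp_mull // expr2 dvdp_mulr.
  by rewrite mul_polyC dvdpZr.
have cdg : coprimep d g.
  set e := gcdp d g; have [ed eg] : e %| d /\ e %| g by rewrite dvdp_gcdl dvdp_gcdr.
  rewrite /coprimep -/e (unit_of e f) //.
    by apply: coprimep_dvdr eg _; rewrite coprimep_sym.
  have := dvdp_trans ed dD; rewrite /D.
  have -> : (f + 'X * g) ^+ 2 = f ^+ 2 + ('X ^+ 2 * g) * g by ring: two0.
  by rewrite dvdp_addl // dvdp_mull.
have dX : d %| 'X by move: dS; rewrite /S mulrC Gauss_dvdpr // coprimepMr cdf.
apply: (unit_of d f cdf); move: dD; rewrite /D.
have -> : (f + 'X * g) ^+ 2 = f ^+ 2 + 'X * ('X * g ^+ 2) by ring: two0.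
by rewrite dvdp_addl // dvdp_mulr.
Qed.

(** For coprime f and g this is one more than the height of f/g; the abscissa at infinity is g =
    0. *)
Definition psize f g := maxn (size f) (size g).

(** Gauss's lemma at the infinite place, for the product of the linear forms g0 z + f0 and g1 z +
    f1. *)
Lemma psize_mul f0 g0 f1 g1 : (0 < psize f0 g0)%N -> (0 < psize f1 g1)%N ->
  maxn (maxn (size (g0 * g1)) (size (f0 * g1 + f1 * g0))) (size (f0 * f1))
  = (psize f0 g0 + psize f1 g1)%N.-1.
Proof.
rewrite /psize => p0 p1.
have mul_le (f g : {poly F}) : (size (f * g)%R <= (size f + size g).-1)%N
  by exact: size_polyMleq.
have mul_eq (f g : {poly F}) : (0 < size f)%N -> (0 < size g)%N ->
    size (f * g) = (size f + size g)%N.-1.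
  by rewrite !size_poly_gt0; apply: size_mul.
have add_le (f g : {poly F}) : (size (f + g)%R <= maxn (size f) (size g))%N
  by exact: size_polyD.
have [h1 h2] := (mul_le g0 g1, mul_le f0 f1).
have [h3 h4] := (mul_le f0 g1, mul_le f1 g0).
have h5 := add_le (f0 * g1) (f1 * g0).
have lt_eq : (size (f1 * g0)%R < size (f0 * g1)%R)%N \/ (size (f0 * g1)%R < size (f1 * g0)%R)%N ->
    size (f0 * g1 + f1 * g0) = maxn (size (f0 * g1)) (size (f1 * g0)).
  by case=> l; [rewrite size_polyDl | rewrite addrC size_polyDl];
    rewrite ?(maxn_idPl (ltnW l)) ?(maxn_idPr (ltnW l)).
move: (mul_eq f0 f1) (mul_eq f0 g1) (mul_eq f1 g0) (mul_eq g0 g1) p0 p1 h1 h2 h3 h4 h5 lt_eq.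
move: (size (f0 * g1 + f1 * g0)) (size (g0 * g1)) (size (f0 * f1)) (size (f0 * g1))
  (size (f1 * g0)).
move: (size f0) (size f1) (size g0) (size g1) => {mul_le mul_eq add_le}.
move=> a b c d e i j u v e1 e2 e3 e4 p0 p1 h1 h2 h3 h4 h5 lt_eq.
(* The product of the larger coefficients of the two forms has full degree; if it occurs in the
   middle coefficient, the other summand there is strictly smaller. *)
case: (leqP c a) p0 => l0 p0; case: (leqP d b) p1 => l1 p1.
- by move: (e1 p0 p1) => {e1 e2 e3 e4}; lia.
- by move: (e2 p0 p1) => {e1 e2 e3 e4}; lia.
- by move: (e3 p1 p0) => {e1 e2 e3 e4}; lia.
by move: (e4 p0 p1) => {e1 e2 e3 e4}; lia.
Qed.

(** The dominant term is X^2 f^2, from P, if deg g <= deg f, and X^2 g^2, from D, otherwise. *)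
Lemma psize_DSP f g : (0 < psize f g)%N ->
  maxn (maxn (size (D f g)) (size (S f g))) (size (P f g)) = (2 * psize f g)%N.+1.
Proof.
rewrite /psize /D /S /P => p0.
have sq (h : {poly F}) : size (h ^+ 2) = (2 * size h)%N.-1.
  have [->|h0] := eqVneq h 0; first by rewrite expr0n size_poly0.
  by rewrite expr2 size_mul // mul2n addnn.
have sX (h : {poly F}) : size ('X * h) = ((0 < size h) + size h)%N.
  have [->|h0] := eqVneq h 0; first by rewrite mulr0 size_poly0.
  by rewrite mulrC size_mulX // size_poly_gt0 h0.
have sA : size (A%:P * g ^+ 2) = (2 * size g)%N.-1 by rewrite mul_polyC size_scale.
have sXf : size ('X ^+ 2 * f ^+ 2) = (2 * (0 < size f) + (2 * size f).-1)%N.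
  by rewrite expr2 -mulrA !sX sq; lia.
have sXfg : (size ('X * (f * g))%R <= (size f + size g))%N.
  rewrite sX; have := size_polyMleq f g; case: (posnP (size (f * g))) => [->|]; lia.
case: (leqP (size g) (size f)) p0 => l p0.
  have -> : size ('X ^+ 2 * f ^+ 2 + A%:P * g ^+ 2) = (2 * size f)%N.+1.
    by rewrite size_polyDl sXf ?sA p0; lia.
  have : (size ((f + 'X * g) ^+ 2)%R <= (2 * size f).+1)%N.
    by have := size_polyD f ('X * g); rewrite sq sX; lia.
  lia.
have -> : size ((f + 'X * g) ^+ 2) = (2 * size g)%N.+1.
  by rewrite sq addrC size_polyDl sX; lia.
have : (size ('X ^+ 2 * f ^+ 2 + A%:P * g ^+ 2)%R <= (2 * size g).+1)%N.
  by apply: leq_trans (size_polyD _ _) _; lia.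
lia.
Qed.

Lemma coprimep_psize f g : coprimep f g -> (0 < psize f g)%N.
Proof.
move=> c; rewrite /psize leq_max !size_poly_gt0 -negb_and; apply/negP =>
  /andP[/eqP f0 /eqP g0].
by move: c; rewrite f0 g0 coprimep0 -size_poly_eq1 size_poly0.
Qed.

(* The two abscissas adjacent to f/g are the roots of D z^2 + S z + P, so they
   are read off from a factorisation of this form; comparing degrees of the
   coefficients gives the parallelogram law for heights. *)
Lemma parallelogram f g f0 g0 f1 g1 : coprimep f g ->
  D f g = g0 * g1 -> S f g = f0 * g1 + f1 * g0 -> P f g = f0 * f1 ->
  (0 < psize f0 g0)%N ->
  [/\ coprimep f1 g1, adjacent f g f1 g1
    & (psize f0 g0 + psize f1 g1 = 2 * psize f g + 2)%N].
Proof.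
move=> c eD eS eP p0.
have c1 : coprimep f1 g1.
  rewrite /coprimep (@adjacent_prim f g) // ?eD ?eS ?eP.
  - exact: dvdp_mull (dvdp_gcdr _ _).
  - apply: dvdp_add; first exact: dvdp_mull (dvdp_gcdr _ _).
    exact: dvdp_mulr (dvdp_gcdl _ _).
  - exact: dvdp_mull (dvdp_gcdl _ _).
split=> //.
  by rewrite adjacentE eD eS eP; ring: two0.
have := psize_mul p0 (coprimep_psize c1).
by rewrite -eD -eS -eP psize_DSP ?coprimep_psize //; have := coprimep_psize c1; lia.
Qed.

(** The known root f0/g0 splits off from D z^2 + S z + P over F[X]: by coprimality g0 divides D and
    f0 divides P. The cofactor g1 z + f1 gives the other root. *)
Lemma adjacent_next f0 g0 f g : coprimep f0 g0 -> coprimep f g ->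
  adjacent f0 g0 f g ->
  exists f1 g1, [/\ coprimep f1 g1, adjacent f g f1 g1
    & (psize f0 g0 + psize f1 g1 = 2 * psize f g + 2)%N].
Proof.
move=> c0 c /adjacentC/adjacentE h; have p0 := coprimep_psize c0.
suff [f1 [g1 [eD eS eP]]] : exists f1 g1,
    [/\ D f g = g0 * g1, S f g = f0 * g1 + f1 * g0 & P f g = f0 * f1].
  by exists f1, g1; apply: parallelogram eD eS eP p0.
have N2 (x y : {poly F}) : x + y = 0 -> x = y.
  by move=> e; rewrite -[x]addr0 -e; ring: two0.
(* The roots at infinity and 0 are treated separately, because the general argument cancels f0
   g0. *)
have [g00|g0n] := eqVneq g0 0.
  have f0u : f0 %| 1.
    by move: c0; rewrite g00 coprimep0 => /eqp_dvdl ->; rewrite dvdpp.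
  have [e1 E1] : exists e, f0 * e = 1.
    by case/dvdpP: (f0u) => e E; exists e; rewrite E mulrC.
  have D0 : D f g = 0.
    move: h; rewrite g00 mulr0 mulr0 expr0n mulr0 !addr0 => h.
    by rewrite -[D f g]mulr1 -(expr1n _ 2) -E1 exprMn mulrA h mul0r.
  exists (e1 * P f g), (e1 * S f g).
  split; first by rewrite D0 g00 mul0r.
    by rewrite g00 mulr0 addr0 mulrA E1 mul1r.
  by rewrite mulrA E1 mul1r.
have [f00|f0n] := eqVneq f0 0.
  have g0u : g0 %| 1.
    by move: c0; rewrite f00 coprime0p => /eqp_dvdl ->; rewrite dvdpp.
  have [e1 E1] : exists e, g0 * e = 1.
    by case/dvdpP: (g0u) => e E; exists e; rewrite E mulrC.
  have P0 : P f g = 0.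
    move: h; rewrite f00 mul0r mulr0 expr0n mulr0 !add0r => h.
    by rewrite -[P f g]mulr1 -(expr1n _ 2) -E1 exprMn mulrA h mul0r.
  exists (e1 * S f g), (e1 * D f g).
  split; first by rewrite mulrA E1 mul1r.
    by rewrite f00 mul0r add0r mulrC mulrA E1 mul1r.
  by rewrite P0 f00 mul0r.
have gD : g0 %| D f g.
  rewrite -(@Gauss_dvdpl _ _ (f0 ^+ 2)) ?coprimep_expr 1?coprimep_sym //.
  rewrite -(dvdp_addl _ (_ : g0 %| S f g * (f0 * g0) + P f g * g0 ^+ 2)).
    by rewrite addrA h dvdp0.
  by rewrite dvdp_add // ?expr2 !dvdp_mull.
have fP : f0 %| P f g.
  rewrite -(@Gauss_dvdpl _ _ (g0 ^+ 2)) ?coprimep_expr //.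
  rewrite -(dvdp_addr _ (_ : f0 %| D f g * f0 ^+ 2 + S f g * (f0 * g0))).
    by rewrite h dvdp0.
  by apply: dvdp_add; [rewrite expr2 !dvdp_mull | rewrite mulrCA dvdp_mulr].
case/dvdpP: gD h => g1 ->; case/dvdpP: fP => f1 -> h.
exists f1, g1; rewrite ![_ * f0]mulrC ![_ * g0]mulrC; split=> //.
apply: (mulfI (mulf_neq0 f0n g0n)); apply: N2; rewrite -h; ring.
Qed.

(** By the parallelogram law the heights along the chain have constant second difference 2, so they
    form a quadratic polynomial fixed by its first two values. Heights are nonnegative. *)
Lemma height_quadratic (q : nat) (r : int) f0 g0 f1 g1 :
  coprimep f0 g0 -> coprimep f1 g1 -> adjacent f0 g0 f1 g1 ->
  psize f0 g0 = q.+1 -> (psize f1 g1)%:Z = q%:Z + 2 - r ->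
  forall n : nat, 0 <= n%:Z ^+ 2 - r * n%:Z + q%:Z.
Proof.
move=> c0 c1 a01 s0 s1 n.
suff [f [g [f' [g' [c c' a [s s']]]]]] : exists f g f' g',
    [/\ coprimep f g, coprimep f' g', adjacent f g f' g'
      & (psize f g)%:Z = n%:Z ^+ 2 - r * n%:Z + q%:Z + 1
        /\ (psize f' g')%:Z = (n.+1)%:Z ^+ 2 - r * (n.+1)%:Z + q%:Z + 1].
  by have := coprimep_psize c; lia.
elim: n => [|n [f [g [f' [g' [c c' a [s s']]]]]]].
  exists f0, g0, f1, g1; split=> //; split; first by rewrite s0; lia.
  by rewrite s1; lia.
have [f2 [g2 [c2 a2 s2]]] := adjacent_next c c' a.
exists f', g', f2, g2; split=> //; split=> //.
have -> : (psize f2 g2)%:Z = 2 * (psize f' g')%:Z + 2 - (psize f g)%:Z by lia.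
by rewrite s s' -!natz -!natr1; ring.
Qed.

End Height.

(** * The Weil bound for Kloosterman sums *)

Section Kloosterman_bound.
Variables (F : finFieldType) (m : nat) (b : F).
Hypotheses (cardF : #|F| = (2 ^ m)%N) (m_gt0 : (0 < m)%N) (b_neq0 : b != 0).

Let q := (2 ^ m)%N.
Let F2 := card2_pchar cardF.
Let two0 : 2%:R = 0 :> {poly F}.
Proof. by rewrite -polyC_natr (pcharf0 F2). Qed.
Let b2_neq0 : b ^+ 2 != 0. Proof. by rewrite expf_neq0. Qed.
Let q_gt1 : (1 < q)%N. Proof. by rewrite -(expn0 2) ltn_exp2l. Qed.

Let arg (x : F) := x + b / x.
Let tr1 (x : F) : bool := trace2 m (arg x) == 1.

(** The Kloosterman sum without its term at 0, after x -> 1/x; see [Kloosterman_Kl]. *)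
Definition Kl : int := \sum_(x : F | x != 0) chi (trace2 m (x + b / x)).

(* W = X^q w with w = sum_(1 <= i <= m) (X + b/X)^(2^i), so that
   w (w + 1) = (B + B^q)^2 for B = X + b/X.  The abscissas adjacent to X^q are
   X^(q+1) (w + e) / (X^q + X)^2, e = 0, 1; at a nonzero x in F, w takes the
   value Tr(x + b/x), so the factor E_ e ^+ 2 of the denominator cancels. *)
Let u i : {poly F} := 'X^(q + 2 ^ i) + (b ^+ (2 ^ i))%:P * 'X^(q - 2 ^ i).
Let W : {poly F} := \sum_(i < m) u i.+1.
Let W_ (e : bool) : {poly F} := W + e%:R * 'X^q.
Let E_ (e : bool) : {poly F} :=
  \prod_(x : F | (x != 0) && (tr1 x == e)) ('X - x%:P).
Let N_ (e : bool) := #|[pred x : F | (x != 0) && (tr1 x == e)]|.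

(** This is X^q (B + B^q), factored so that the roots in F are visible. *)
Let V : {poly F} := ('X^(q.-1) + 1) * ('X^(q.+1) + b%:P).

(** Artin-Schreier telescoping: w^2 + w = B^(2q) + B^2, multiplied by X^(2q). *)
Lemma W_mul : W_ false * W_ true = V ^+ 2.
Proof.
(* [u i] stands for X^q B^(2^i). The bound on i keeps the truncated subtraction in the exponent
   exact. *)
have uS i : (i < m)%N -> u i ^+ 2 = 'X^q * u i.+1.
  move=> lim; have : (2 ^ i.+1 <= q)%N by rewrite leq_exp2l.
  rewrite expnS => l; rewrite /u expnS.
  pose y : {poly F} := 'X^(q - 2 * 2 ^ i); pose z : {poly F} := 'X^(2 ^ i).
  have e1 : 'X^(q + 2 ^ i) = y * z ^+ 3 by rewrite -exprM -exprD; congr ('X^_); lia.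
  have e2 : 'X^(q - 2 ^ i) = y * z by rewrite -exprD; congr ('X^_); lia.
  have e3 : 'X^(q + 2 * 2 ^ i) = y * z ^+ 4 by rewrite -exprM -exprD; congr ('X^_); lia.
  have e4 : 'X^q = y * z ^+ 2 by rewrite -exprM -exprD; congr ('X^_); lia.
  by rewrite e1 e2 e3 e4 -/y mulnC exprM (polyC_exp 2); ring: two0.
have sW j : (j <= m)%N ->
    (\sum_(i < j) u i.+1) ^+ 2 + 'X^q * (\sum_(i < j) u i.+1) = u j ^+ 2 + u 0%N ^+ 2.
  elim: j => [|j IH] lj.
    by rewrite !big_ord0 expr2 !mulr0 addr0; ring: two0.
  rewrite big_ord_recr /=; have := IH (ltnW lj); have := uS j lj.
  set s := \sum_(i < j) _ => e1 e2.
  have -> : (s + u j.+1) ^+ 2 + 'X^q * (s + u j.+1) =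
     (s ^+ 2 + 'X^q * s) + u j.+1 ^+ 2 + 'X^q * u j.+1 by ring: two0.
  by rewrite e2 -e1; ring: two0.
rewrite /W_ mul0r addr0 mul1r mulrDr -expr2 [W * _]mulrC sW // /V /u expn0 expr1.
rewrite subnn expr0 expf_cardk // addn1 subn1 (_ : (q + 2 ^ m = q.-1 + q.+1)%N); last
  by rewrite -/q; lia.
by rewrite exprD; ring: two0.
Qed.

Lemma E_mul : E_ false * E_ true = 'X^(q.-1) + 1.
Proof.
have X0 : 'X != 0 :> {poly F} by rewrite polyX_eq0.
apply: (mulfI X0); rewrite mulrDr mulr1 -exprS prednK ?expn_gt0 //.
transitivity ('X^q - 'X : {poly F}); last first.
  by congr (_ + _); rewrite oppr_pchar2 // inE /= two0 eqxx.
rewrite /q -cardF finField_genPoly (bigD1 (0 : F)) // subr0; congr (_ * _).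
rewrite (bigID (fun x => tr1 x == false)); congr (_ * _); apply: eq_bigl => x;
  by case: (tr1 x).
Qed.

Lemma size_E e : size (E_ e) = (N_ e).+1.
Proof.
rewrite /E_ -big_filter size_prod_XsubC; congr _.+1.
by rewrite /N_ cardE /enum_mem; congr size; apply: eq_filter => x; rewrite inE.
Qed.

Lemma W_eval e (x : F) : x != 0 -> (W_ e).[x] = x * (tr1 x (+) e)%:R.
Proof.
move=> x0; have xq : x ^+ q = x by rewrite expf_cardk.
have -> : (W_ e).[x] = x * ((trace2 m (arg x) : nat)%:R + e%:R).
  rewrite /W_ hornerD hornerM hornerXn xq mulrDr [x * e%:R]mulrC; congr (_ + _).
    rewrite -(tr_sqr cardF) trE // mulr_sumr horner_sum; apply: eq_bigr => i _.
    rewrite -exprM -expnS /u (expD2X cardF) hornerD hornerM !hornerXn hornerC expr_div_n exprD xq mulrDr.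
    congr (_ + _); have l : (2 ^ i.+1 <= q)%N by rewrite leq_exp2l.
    have {2}<- : x ^+ (q - 2 ^ i.+1) * x ^+ (2 ^ i.+1) = x by rewrite -exprD subnK.
    rewrite mulrC -mulrA [_ / _]mulrC; congr (_ * _).
    by rewrite mulrA mulfV ?mul1r // expf_neq0.
  by case: e; rewrite ?horner0 // -[1 : {poly F}]/(1%:P) hornerC.
congr (_ * _); rewrite /tr1; case: (F2P (trace2 m (arg x))) => ->; case: e;
  rewrite ?addr0 ?add0r //=.
by rewrite (addxx2 cardF).
Qed.

(** Only the last summand, [u m], has a constant term, namely b^q = b. *)
Lemma W_eval0 e : (W_ e).[0] = b.
Proof.
rewrite /W_ hornerD hornerM hornerXn expr0n (gtn_eqF (ltnW q_gt1)) mulr0 addr0.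
rewrite /W horner_sum -(prednK m_gt0) big_ord_recr /= big1 ?add0r => [|i _].
  rewrite /u hornerD hornerM !hornerXn hornerC prednK // subnn expr0 mulr1 expf_cardk //.
  by rewrite expr0n addn_eq0 (gtn_eqF (ltnW q_gt1)) add0r.
rewrite /u hornerD hornerM !hornerXn !expr0n addn_eq0 (gtn_eqF (ltnW q_gt1)) add0r.
have : (2 ^ i.+1 < q)%N by rewrite ltn_exp2l //; have := ltn_ord i; lia.
by move=> l; rewrite subn_eq0 leqNgt l mulr0.
Qed.

Lemma size_W e : (size (W_ e) <= (2 * q).+1)%N.
Proof.
have hX d (c : {poly F}) : (d <= 2 * q)%N -> (size c <= 1)%N -> (size (c * 'X^d)%R <= (2 * q).+1)%N.
  by move=> ld lc; apply: leq_trans (size_polyMleq _ _) _; rewrite size_polyXn; lia.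
apply: leq_trans (size_polyD _ _) _; rewrite geq_max; apply/andP; split; last first.
  by apply: hX; [lia | case: e; rewrite ?size_poly0 ?size_poly1].
apply: leq_trans (size_sum _ _ _) _; apply/bigmax_leqP => i _.
have l : (2 ^ i.+1 <= q)%N by rewrite leq_exp2l.
apply: leq_trans (size_polyD _ _) _; rewrite geq_max; apply/andP; split.
  by rewrite size_polyXn; lia.
by apply: hX; [lia | rewrite size_polyC leq_b1].
Qed.

Lemma coprime_E e (p : {poly F}) :
  (forall x, x != 0 -> tr1 x == e -> p.[x] != 0) -> coprimep (E_ e) p.
Proof.
move=> h; rewrite /E_; apply: (big_ind (fun r => coprimep r p)) => [|r s|x].
- exact: coprime1p.
- by rewrite coprimepMl => -> ->.
by case/andP=> x0 tx; rewrite coprimep_sym coprimep_XsubC; apply: h.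
Qed.

(** The square of [E_ e] divides V^2 = [W_ e * W_ (~~ e)], and the second factor takes the value x
    != 0 at each root x of [E_ e]. *)
Lemma E2_dvd_W e : E_ e ^+ 2 %| W_ e.
Proof.
have c : coprimep (E_ e ^+ 2) (W_ (~~ e)).
  rewrite coprimep_expl //; apply: coprime_E => x x0 /eqP te.
  by rewrite W_eval // te; case: (e); rewrite mulr1.
rewrite -(Gauss_dvdpl _ c).
have -> : W_ e * W_ (~~ e) = V ^+ 2 by rewrite -W_mul; case: (e); rewrite // mulrC.
by rewrite dvdp_exp2r // /V -E_mul dvdp_mulr //; case: (e);
  [exact: dvdp_mulIr | exact: dvdp_mulIl].
Qed.

(** The chain starts with X^q, of height q, and f e / g e. The height of the latter, 2 [N_ (~~ e)] +
    2, is q + 1 - (-1)^e Kl, as the two counts have sum q - 1 and difference Kl. *)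
Lemma quad_ge0 (e : bool) (n : nat) :
  0 <= n%:Z ^+ 2 - (-1) ^+ e * Kl * n%:Z + q%:Z.
Proof.
have [w0 e0] : exists w, W_ false = w * E_ false ^+ 2 by apply/dvdpP/E2_dvd_W.
have [w1 e1] : exists w, W_ true = w * E_ true ^+ 2 by apply/dvdpP/E2_dvd_W.
pose w (e : bool) := if e then w1 else w0.
have eW e' : W_ e' = w e' * E_ e' ^+ 2 by case: e'.
have E0n e' : E_ e' != 0 by rewrite -size_poly_eq0 size_E.
pose f e' := w e'; pose g e' := 'X * E_ (~~ e') ^+ 2.
have fg_coprime e' : coprimep (f e') (g e').
  have w_eval x : (W_ e').[x] != 0 -> (w e').[x] != 0.
    by rewrite eW hornerM; apply: contraNneq => ->; rewrite mul0r.
  rewrite /g coprimepMr; apply/andP; split.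
    by rewrite -['X]subr0 coprimep_XsubC w_eval // W_eval0.
  rewrite coprimep_sym coprimep_expl //; apply: coprime_E => x x0 /eqP tx.
  by apply: w_eval; rewrite W_eval // tx; case: (e'); rewrite mulr1.
have q0 : (0 < q)%N by rewrite expn_gt0.
have XE : 'X * (E_ false * E_ true) = 'X^q + 'X :> {poly F}.
  by rewrite E_mul mulrDr mulr1 -exprS prednK.
(* The form D z^2 + S z + P attached to X^q / 1 is the product of the forms g z + f for the two
   values of e'. *)
have eD e' : ('X^q + 'X * 1) ^+ 2 = g e' * g (~~ e') :> {poly F}.
  by rewrite mulr1 -XE /g; case: (e') => /=; ring.
have eS e' : 'X * ('X^q * 1) = f e' * g (~~ e') + f (~~ e') * g e' :> {poly F}.
  have -> : f e' * g (~~ e') + f (~~ e') * g e' = 'X * (W_ e' + W_ (~~ e')).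
    by rewrite !eW /f /g !negbK; ring.
  rewrite mulr1; congr (_ * _); rewrite /W_; case: (e') => /=; ring: two0.
have eP e' : 'X ^+ 2 * 'X^q ^+ 2 + (b ^+ 2)%:P * 1 ^+ 2 = f e' * f (~~ e') :> {poly F}.
  have VE : (f e' * f (~~ e')) * ('X^(q.-1) + 1) ^+ 2 =
      ('X^(q.+1) + b%:P) ^+ 2 * ('X^(q.-1) + 1) ^+ 2.
    have -> : ('X^(q.+1) + b%:P) ^+ 2 * ('X^(q.-1) + 1) ^+ 2 = V ^+ 2.
      by rewrite /V exprMn mulrC.
    by rewrite -W_mul !eW -E_mul /f; case: (e') => /=; ring.
  have := mulIf (expf_neq0 2 _) VE => ->.
    by rewrite (exprS 'X q) (polyC_exp 2); ring: two0.
  by rewrite -E_mul mulf_neq0.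
have cX : coprimep ('X^q) (1 : {poly F}) by rewrite coprimep1.
have pX : psize ('X^q) (1 : {poly F}) = q.+1.
  by rewrite /psize size_polyXn size_poly1; lia.
have par e' :=
  parallelogram F2 b2_neq0 cX (eD e') (eS e') (eP e') (coprimep_psize (fg_coprime e')).
have Nsum : (N_ false + N_ true = q.-1)%N.
  have := congr1 (fun p : {poly F} => size p) E_mul.
  by rewrite size_mul // !size_E size_polyDl size_polyXn ?size_poly1; lia.
have szw e' : (size (w e') + 2 * N_ e' <= (2 * q).+1)%N.
  have := size_W e'; rewrite eW size_mul ?expf_neq0 //; last first.
    by apply: contraTneq (fg_coprime e') => /= w00; rewrite /f w00 coprime0p /g
      -size_poly_eq1 size_mul ?expf_neq0 ?polyX_eq0 // size_polyX expr2 size_mul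
        // !size_E; lia.
  rewrite expr2 size_mul // !size_E; move: (size (w e')) (N_ e') => i j. clear; lia.
have szg e' : size (g e') = (2 * N_ (~~ e') + 2)%N.
  by rewrite /g size_mul ?polyX_eq0 ?expf_neq0 // size_polyX expr2 size_mul // !size_E; lia.
(* Each size is at most 2 N + 3 by [szw] and [szg]. By the parallelogram law the two sizes add up to
   2 q + 4, the sum of these bounds, so both are attained. *)
have szfg e' : (psize (f e') (g e') = 2 * N_ (~~ e') + 3)%N.
  have [_ _] := par e'; rewrite pX /psize /f !szg negbK.
  have := (szw e'); have := szw (~~ e'); move: Nsum.
  move: (size (w e')) (size (w (~~ e'))) => s s'.
  by case: (e') => /=; move: (N_ true) (N_ false) => i j; lia.
have Kl_N : Kl = (N_ false)%:Z - (N_ true)%:Z.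
  have sumN e' : \sum_(x : F | (x != 0) && (tr1 x == e')) chi (trace2 m (x + b / x))
      = (-1) ^+ e' * (N_ e')%:Z.
    rewrite (eq_bigr (fun=> (-1) ^+ e')) => [|x /andP[_ /eqP <-]]; last first.
      by rewrite /tr1 /arg; case: (F2P (trace2 m (x + b / x))) => ->.
    by rewrite sumr_const -[LHS]mulr_natr natz.
  have -> : (N_ false)%:Z - (N_ true)%:Z
    = (-1) ^+ false * (N_ false)%:Z + (-1) ^+ true * (N_ true)%:Z.
    by rewrite mul1r expr1 mulN1r.
  rewrite -!sumN /Kl (bigID (fun x => tr1 x == false)); congr (_ + _).
  by apply: eq_bigl => x; case: (tr1 x).
have [c a _] := par (~~ e).
apply: (height_quadratic F2 b2_neq0 cX (fg_coprime e)) => //.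
  by have [_ + _] := par (~~ e); rewrite negbK.
by rewrite szfg Kl_N; case: (e) => /=; move: Nsum; move: (N_ true) (N_ false) => i j; lia.
Qed.

End Kloosterman_bound.

(** * The quadratic form and its radical *)

Section Form.
Variables (F : finFieldType) (m : nat) (a : F).
Hypotheses (cardF : #|F| = (2 ^ m)%N) (m_gt0 : (0 < m)%N) (m_even : ~~ odd m).
Hypothesis a_neq0 : a != 0.

Notation tr := (@trace2 F m).
Notation c := (a^-1).
Let two0 : 2%:R = 0 :> F. Proof. exact: card2_natr2 cardF. Qed.
Let four0 : 4%:R = 0 :> F. Proof. by rewrite (natrM _ 2 2) two0 mul0r. Qed.
Let six0 : 6%:R = 0 :> F. Proof. by rewrite (natrM _ 2 3) two0 mul0r. Qed.
Let ac1 : a * c = 1. Proof. exact: mulfV. Qed.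

(** The linearised polynomial whose roots form the radical of [sform]; see [sformE]. *)
Definition radp (z : F) : F := a ^+ 4 * z ^+ 16 + a ^+ 4 * z ^+ 8 + a ^+ 2 * z ^+ 2 + a * z.

Lemma radpD x y : radp (x + y) = radp x + radp y.
Proof.
have e i : (x + y) ^+ (2 ^ i) = x ^+ (2 ^ i) + y ^+ (2 ^ i) by exact: expD2X cardF _ _ _.
by rewrite /radp (e 4%N) (e 3%N) (e 1%N); ring.
Qed.

Lemma qformD x y : qform m a (x + y) = qform m a x + qform m a y + sform m a x y.
Proof.
rewrite /qform /sform -!(trD cardF); congr trace2.
by rewrite (expD2X cardF 2%N) (expD2X cardF 1%N); ring.
Qed.

(** Invariance of the trace under Frobenius allows the terms of degree 1 and 2 in x to be raised to
    degree 4; the two terms a^2 x y cancel. *)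
Lemma sformE x y : sform m a x y = tr (x ^+ 4 * radp y).
Proof.
have t4 z : tr z = tr (z ^+ 4) by rewrite -(tr_exp2 cardF 2%N).
have -> : x ^+ 4 * radp y = (x * (a * y ^+ 4 + a * y ^+ 2)) ^+ 4
    + (a * x ^+ 2 * y) ^+ 2 + a * x ^+ 4 * y.
  by rewrite exprMn (expD2X cardF 2%N) /radp; ring.
rewrite !(trD cardF) -t4 (tr_sqr cardF) -!(trD cardF) /sform; congr trace2.
by ring: two0.
Qed.

Lemma sformC x y : sform m a x y = sform m a y x.
Proof. by rewrite /sform; congr trace2; ring. Qed.

Lemma sformDl x y z : sform m a (x + y) z = sform m a x z + sform m a y z.
Proof.
by rewrite !sformE -(trD cardF) (expD2X cardF 2%N) mulrDl.
Qed.

Lemma sform_xx x : sform m a x x = 0.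
Proof. by rewrite /sform (addxx2 cardF) (tr0 cardF). Qed.

Lemma sum_sform y :
  \sum_(x : F) chi (sform m a x y) = (2 ^ m * (radp y == 0))%:Z.
Proof.
(* With [radp y] = r^4 the summand becomes a character value at r x. *)
have [s es] := sqr_surj2 cardF (radp y); have [r er] := sqr_surj2 cardF s.
under eq_bigr => x _.
  rewrite sformE (_ : x ^+ 4 * _ = (r * x) ^+ (2 ^ 2)); last by rewrite es er; ring.
  rewrite (tr_exp2 cardF); over.
by rewrite (sum_chi_tr cardF m_gt0) es er !sqrf_eq0.
Qed.

Definition qsum : int := \sum_(x : F) chi (qform m a x).

Lemma qform0 : qform m a 0 = 0.
Proof. by rewrite /qform mul0r (tr0 cardF). Qed.

(** Writing the second variable as x + z turns the square into the sum over z of chi (q z) times the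
    sum over x of chi (sform x z), which vanishes off the radical. *)
Lemma qsum_sqr :
  qsum ^+ 2 = (2 ^ m)%:Z * \sum_(z | radp z == 0) chi (qform m a z).
Proof.
rewrite expr2 /qsum mulr_suml.
under eq_bigr => x _.
  rewrite mulr_sumr (reindex_inj (addrI x)) /=.
  under eq_bigr => z _.
    rewrite qformD -chiD !addrA addFF add0r chiD; over.
  over.
rewrite exchange_big /= mulr_sumr [RHS]big_mkcond /=; apply: eq_bigr => z _.
rewrite -mulr_sumr sum_sform; case: eqP => _; rewrite ?muln0 ?mulr0 // muln1 mulrC //.
Qed.

Lemma qform_rad_additive x y : radp y = 0 -> qform m a (x + y) = qform m a x + qform m a y.
Proof. by move=> ry; rewrite qformD sformE ry mulr0 (tr0 cardF) addr0. Qed.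

Lemma qsum_eq0 z : radp z = 0 -> qform m a z = 1 -> qsum = 0.
Proof.
move=> rz qz; apply/eqP; rewrite -sqrf_eq0 qsum_sqr.
rewrite (@sum_chi_involution _ [pred z | radp z == 0] _ (fun x => x + z)) ?mulr0 // => x.
- by rewrite -addrA (addxx2 cardF) addr0.
- by rewrite !inE radpD rz addr0.
by move=> _; rewrite qform_rad_additive // qz.
Qed.

Lemma qsum_sqr_card : (forall z, radp z = 0 -> qform m a z = 0) ->
  qsum ^+ 2 = (2 ^ m)%:Z * #|[set z | radp z == 0]|%:Z.
Proof.
move=> h; rewrite qsum_sqr; congr (_ * _).
rewrite (eq_bigr (fun=> 1)) => [|z /eqP/h -> //].
by rewrite sumr_const cardsE natz.
Qed.

(** Over an algebraic closure the factors account for 0, the five roots of p and the ten sums of two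
    of them. *)
Lemma radp_factor z : radp z
  = a ^+ 4 * z * (z ^+ 5 + z + c) * (z ^+ 10 + z ^+ 6 + c * z ^+ 5 + c ^+ 2).
Proof. rewrite /radp; ring: two0 ac1. Qed.

Lemma qformE z : qform m a z = tr (a * z ^+ 5 + a * z ^+ 3 + a * z).
Proof.
rewrite /qform (_ : z * _ = a * z ^+ 5 + a * z ^+ 3 + (a * z) ^+ 2); last by ring.
by rewrite (trD cardF) (tr_sqr cardF) -(trD cardF).
Qed.

(** With e = 1/(r + 1) the equation gives a r^5 + a r = 1, of trace 0 as m is even, and a r^3 = (e +
    e^2)^2, also of trace 0. *)
Lemma qform_root r : r ^+ 5 + r + c = 0 -> qform m a r = 0.
Proof.
move=> pr; have r1 : r + 1 != 0.
  apply/eqP => e; have : c = 0; last by move/eqP; rewrite invr_eq0 (negPf a_neq0).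
  have -> : c = (r ^+ 5 + r + c) + r * (r + 1) ^+ 3 * (r + 1) by ring: two0 four0 six0.
  by rewrite pr e mulr0 addr0.
have ar : a * r ^+ 5 + a * r = 1.
  have -> : a * r ^+ 5 + a * r = a * (r ^+ 5 + r + c) + 1 by ring: two0 ac1.
  by rewrite pr mulr0 add0r.
pose e := (r + 1)^-1; have e1 : e * (r + 1) = 1 by rewrite mulVf.
have are : a * r = e ^+ 4.
  transitivity (a * r * (e * (r + 1)) ^+ 4); first by rewrite e1 expr1n mulr1.
  transitivity (e ^+ 4 * (a * r ^+ 5 + a * r)); last by rewrite ar mulr1.
  by ring: two0 four0 six0.
have ar3 : a * r ^+ 3 = (e + e ^+ 2) ^+ 2.
  have -> : (e + e ^+ 2) ^+ 2 = e ^+ 4 * (1 + (r + 1) ^+ 2).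
    have h : e ^+ 2 = e ^+ 4 * (r + 1) ^+ 2.
      transitivity (e ^+ 2 * (e * (r + 1)) ^+ 2); last by ring.
      by rewrite e1 expr1n mulr1.
    by rewrite mulrDr -h; ring: two0.
  by rewrite -are; ring: two0.
rewrite qformE [_ + a * r]addrAC ar ar3 (trD cardF) (tr1_even cardF) // add0r.
by rewrite (tr_sqr cardF) (trD cardF) (tr_sqr cardF) addFF.
Qed.

(** Put v = c/z^5, i = 1/v and w = 1/z. The equation reads v^2 + v + 1 = w^4, so i w^4 = v + 1 + i,
    and i w^2 has the trace of its square 1 + i + i^2. *)
Lemma qform_pair_sum z : z != 0 -> z ^+ 10 + z ^+ 6 + c * z ^+ 5 + c ^+ 2 = 0 ->
  qform m a z = tr (c / z ^+ 5).
Proof.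
move=> z0 hz; pose w := z^-1; have zw : z * w = 1 by exact: mulfV.
pose v := c * w ^+ 5; pose i := a * z ^+ 5.
have iv : i * v = 1.
  transitivity ((a * c) * (z * w) ^+ 5); first by rewrite /i /v; ring.
  by rewrite zw ac1 expr1n mulr1.
have vw : v ^+ 2 + v + 1 = w ^+ 4.
  have -> : w ^+ 4 = w ^+ 4 + w ^+ 10 * (z ^+ 10 + z ^+ 6 + c * z ^+ 5 + c ^+ 2).
    by rewrite hz mulr0 addr0.
  by rewrite /v; ring: two0 zw.
have -> : c / z ^+ 5 = v by rewrite /v exprVn.
rewrite qformE (_ : _ + _ = i + i * w ^+ 2 + i * w ^+ 4); last first.
  by rewrite /i; ring: zw.
have -> : i * w ^+ 4 = v + 1 + i by rewrite -vw; ring: iv.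
rewrite !(trD cardF) -(tr_sqr cardF (i * _)).
have -> : (i * w ^+ 2) ^+ 2 = 1 + (i + i ^+ 2).
  by rewrite (_ : _ ^+ 2 = i ^+ 2 * w ^+ 4); [rewrite -vw; ring: iv | ring].
rewrite !(trD cardF) (tr_sqr cardF) addFF addr0; move: (tr i) (tr 1) (tr v) => x y t.
by case: (F2P x) => ->; case: (F2P y) => ->; case: (F2P t) => ->; apply/val_inj.
Qed.

(* v = Y^3 / (Y + 1) rewrites the equation as Y^3 + v Y + v = 0; two different
   roots Y, Y' give (Y'/Y)^2 + Y'/Y = 1 / (Y + 1), so v is injective where the
   right-hand side has trace 1, and a count makes it onto. *)
Lemma cubic_root v : tr v = 1 -> exists y, y ^+ 3 + v * y + v = 0.
Proof.
move=> tv; have t1 := tr1_even cardF m_even.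
pose T := [set y : F | tr (y + 1)^-1 == 1]; pose g (y : F) := y ^+ 3 / (y + 1).
have Tn y : y \in T -> [/\ y != 0, y + 1 != 0 & tr (y + 1)^-1 = 1].
  rewrite inE => /eqP ty; split=> //; apply: contra_eq_neq ty.
    by move=> ->; rewrite add0r invr1 t1.
  by move=> ->; rewrite invr0 (tr0 cardF).
have gE y : y + 1 != 0 -> g y = y ^+ 2 + y + 1 + (y + 1)^-1.
  move=> y1; apply: (mulIf y1); rewrite /g divfK // mulrDl mulVf //.
  by ring: two0.
have ginj : {in T &, injective g}.
  move=> y y' /Tn[y0 y1 ty] /Tn[y0' y1' ty'] e; apply/eqP; apply/negPn/negP => ne.
  have hy : y ^+ 3 + g y * y + g y = 0.
    have -> : y ^+ 3 = g y * (y + 1) by rewrite divfK.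
    by ring: two0.
  have hy' : y' ^+ 3 + g y * y' + g y = 0.
    have -> : y' ^+ 3 = g y * (y' + 1) by rewrite e divfK.
    by ring: two0.
  have hs : y ^+ 2 + y * y' + y' ^+ 2 + g y = 0.
    have ne' : y + y' != 0 by rewrite addr_eq0 (oppr2 cardF).
    apply: (mulfI ne'); rewrite mulr0 -[RHS](addr0 0) -{1}hy -hy'; ring: two0.
  have : tr (y + 1)^-1 = 0.
    apply/(hilbert90 cardF m_gt0); exists (y' / y).
    have y2 : y ^+ 2 != 0 by rewrite expf_neq0.
    apply: (mulIf y2); apply: (mulIf y1).
    have -> : ((y' / y) ^+ 2 + y' / y) * y ^+ 2 * (y + 1) = (y' ^+ 2 + y * y') * (y + 1).
      by field.
    rewrite (_ : _ * _ * (y + 1) = y ^+ 2) 1?mulrAC ?mulVf ?mul1r //.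
    have -> : y' ^+ 2 + y * y' = y ^+ 2 + g y.
      by rewrite -[LHS]addr0 -hs; ring: two0.
    by rewrite mulrDl divfK //; ring: two0.
  by rewrite ty.
have gT : g @: T = [set x | tr x == 1].
  apply/eqP; rewrite eqEcard; apply/andP; split.
    apply/subsetP => _ /imsetP[y /Tn[y0 y1 ty] ->]; rewrite inE gE //.
    by rewrite !(trD cardF) (tr_sqr cardF) addFF t1 !add0r ty.
  (* As g is injective on T, only the cardinality of T matters; y -> (y + 1)^-1 maps T bijectively
     to the elements of trace 1. *)
  rewrite card_in_imset //; apply: eq_leq; symmetry.
  have gi : injective (fun y : F => (y + 1)^-1) by move=> x y /invr_inj/addIr.
  rewrite -(card_imset _ gi); apply: eq_card => x; rewrite !inE.
  apply/imsetP/eqP => [[y + ->]|tx]; first by rewrite inE => /eqP.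
  by exists (x^-1 + 1); rewrite ?inE -addrA (addxx2 cardF) addr0 invrK ?tx.
have : v \in g @: T by rewrite gT inE tv.
case/imsetP => y /Tn[y0 y1 _] ev; exists y.
have -> : y ^+ 3 = v * (y + 1) by rewrite ev divfK.
by ring: two0.
Qed.

End Form.

(** * The factorization of X^5 + X + 1/a *)

Section Quintic.
Variables (F : finFieldType) (m : nat) (a : F).
Hypotheses (cardF : #|F| = (2 ^ m)%N) (m_gt0 : (0 < m)%N) (m_even : ~~ odd m).
Hypothesis a_neq0 : a != 0.

Notation tr := (@trace2 F m).
Notation c := (a^-1).
Let two0 : 2%:R = 0 :> F. Proof. exact: card2_natr2 cardF. Qed.
Let four0 : 4%:R = 0 :> F. Proof. by rewrite (natrM _ 2 2) two0 mul0r. Qed.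
Let six0 : 6%:R = 0 :> F. Proof. by rewrite (natrM _ 2 3) two0 mul0r. Qed.
Let five1 : 5%:R = 1 :> F. Proof. by rewrite -natr1 four0 add0r. Qed.
Let ten0 : 10%:R = 0 :> F. Proof. by rewrite (natrM _ 2 5) two0 mul0r. Qed.
Let two0P : 2%:R = 0 :> {poly F}. Proof. by rewrite -polyC_natr two0. Qed.
Let c_neq0 : c != 0. Proof. by rewrite invr_eq0. Qed.

Let p : {poly F} := 'X^5 + 'X + c%:P.
Definition quad (s r : F) : {poly F} := 'X^2 + s%:P * 'X + r%:P.

Lemma size_quintic : size p = 6%N.
Proof.
rewrite /p -addrA size_polyDl size_polyXn // ltnS.
by apply: leq_trans (size_polyD _ _) _; rewrite size_polyX geq_max size_polyC c_neq0.
Qed.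

Lemma horner_quintic x : p.[x] = x ^+ 5 + x + c.
Proof. by rewrite /p !hornerD !hornerXn hornerX hornerC. Qed.

Lemma size_quad s r : size (quad s r) = 3%N.
Proof.
rewrite /quad -addrA size_polyDl size_polyXn // ltnS.
apply: leq_trans (size_polyD _ _) _; rewrite geq_max size_polyC.
by rewrite (leq_trans (size_polyMleq _ _)) ?size_polyX ?size_polyC; case: (s != 0);
  case: (r != 0).
Qed.

(** Euclidean division by X^2 + s X + r, whose remainder yields the divisibility conditions. *)
Lemma quintic_quad s r : p =
  quad s r * ('X^3 + s%:P * 'X^2 + (s ^+ 2 + r)%:P * 'X + (s ^+ 3)%:P)
  + ((s ^+ 4 + s ^+ 2 * r + r ^+ 2 + 1)%:P * 'X + (c + s ^+ 3 * r)%:P).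
Proof. by rewrite /p /quad !(rmorphD, rmorphM, rmorphXn, rmorph1) /=; ring: two0P. Qed.

Lemma quad_dvd s r : quad s r %| p ->
  s ^+ 4 + s ^+ 2 * r + r ^+ 2 = 1 /\ s ^+ 3 * r = c.
Proof.
rewrite (quintic_quad s r) dvdp_addr ?dvdp_mulIl //.
set u := _ + 1; set v := c + _ => d.
have : u%:P * 'X + v%:P = 0.
  apply/eqP; apply: contraTT d => nz; apply/negP => /(dvdp_leq nz).
  rewrite size_quad leqNgt => /negP; apply; rewrite ltnS.
  apply: leq_trans (size_polyD _ _) _; rewrite geq_max size_polyC.
  by rewrite (leq_trans (size_polyMleq _ _)) ?size_polyX ?size_polyC; case: (u != 0);
    case: (v != 0).
move=> e; split; apply: subr0_eq; rewrite (oppr2 cardF).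
  have := congr1 (fun p : {poly F} => p`_1) e.
  by rewrite coefD coefMX !coefC /= addr0.
have := congr1 (fun p : {poly F} => p`_0) e.
by rewrite coefD coefMX !coefC /= add0r addrC.
Qed.

(** What remains of the divisibility conditions on [quad s r] after eliminating r = c/s^3; it is the
    decic factor of [radp]. *)
Definition pair_sum (s : F) := s ^+ 10 + s ^+ 6 + c * s ^+ 5 + c ^+ 2 = 0.

Lemma quad_dvd_pair_sum s r : quad s r %| p -> [/\ s != 0, pair_sum s & r = c / s ^+ 3].
Proof.
case/quad_dvd => e1 e2; have s0 : s != 0.
  by apply: contraTneq c_neq0 => s0; rewrite -e2 s0 expr0n mul0r eqxx.
split=> //.
  rewrite /pair_sum -e2 -[s ^+ 6]mulr1 -e1; ring: two0.
by rewrite -e2 mulrAC mulfV ?mul1r // expf_neq0.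
Qed.

Lemma pair_sum_quad_dvd s : s != 0 -> pair_sum s -> quad s (c / s ^+ 3) %| p.
Proof.
move=> s0 hs; rewrite (quintic_quad s (c / s ^+ 3)).
have s3 : s ^+ 3 != 0 by rewrite expf_neq0.
rewrite (_ : c + _ = 0); last by rewrite mulrCA mulfV // mulr1 (addxx2 cardF).
rewrite (_ : _ + 1 = 0) ?mul0r ?addr0 ?dvdp_mulIl //.
have s6 : s ^+ 6 != 0 by rewrite expf_neq0.
have e : c / s ^+ 3 * s ^+ 3 = c by rewrite divfK.
apply: (mulfI s6); rewrite mulr0 -hs; move: (c / s ^+ 3) e => r <-; ring.
Qed.

(** The substitution X = s x gives s^2 times the Artin-Schreier polynomial x^2 + x + c/s^5, and
    [hilbert90] applies. *)
Lemma quad_irreducible s : s != 0 ->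
  irreducible_poly (quad s (c / s ^+ 3)) <-> tr (c / s ^+ 5) = 1.
Proof.
move=> s0; have s2 : s ^+ 2 != 0 by rewrite expf_neq0.
have hE x : (quad s (c / s ^+ 3)).[s * x] = s ^+ 2 * (x ^+ 2 + x + c / s ^+ 5).
  by rewrite /quad !hornerD hornerXn hornerM hornerX !hornerC; field; rewrite ?s0 ?a_neq0.
split=> [irr|t1].
  case: (F2P (tr (c / s ^+ 5))) => // /(hilbert90 cardF m_gt0)[z hz].
  have rt : root (quad s (c / s ^+ 3)) (s * z).
    by rewrite rootE hE -hz (addxx2 cardF) mulr0.
  case: irr => _ /(_ ('X - (s * z)%:P)); rewrite dvdp_XsubCl.
  rewrite size_XsubC => /(_ isT rt)/eqp_size.
  by rewrite size_XsubC size_quad.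
apply: cubic_irreducible => [|x]; first by rewrite size_quad.
rewrite -[x](mulVKf s0) rootE hE mulf_neq0 //; apply: contra_eq_neq t1 => e.
rewrite (_ : tr _ = 0) //; apply/(hilbert90 cardF m_gt0); exists (s^-1 * x).
by apply/eqP; rewrite -subr_eq0 (oppr2 cardF) e.
Qed.

Lemma radpE z : radp a z = 0 <-> [\/ z = 0, root p z | z != 0 /\ pair_sum z].
Proof.
rewrite (radp_factor cardF a_neq0) rootE horner_quintic; split=> [/eqP|].
  rewrite !mulf_eq0 (negPf a_neq0) /= => /orP[/orP[/eqP ->|->]|/eqP h].
  - by constructor 1.
  - by constructor 2.
  have [->|z0] := eqVneq z 0; first by constructor 1.
  by constructor 3.
case=> [->|/eqP ->|[_ ->]]; by rewrite ?(mulr0, mul0r).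
Qed.

Lemma root_neq0 z : root p z -> z != 0.
Proof.
rewrite rootE horner_quintic; apply: contraTneq => ->.
by rewrite expr0n !add0r c_neq0.
Qed.

Lemma quad_normalise (d : {poly F}) : size d = 3%N -> exists s r, d %= quad s r.
Proof.
move=> sd; have l0 : lead_coef d != 0 by rewrite lead_coef_eq0 -size_poly_eq0 sd.
exists (d`_1 / lead_coef d), (d`_0 / lead_coef d).
suff <- : (lead_coef d)^-1 *: d = quad (d`_1 / lead_coef d) (d`_0 / lead_coef d).
  by rewrite eqp_sym eqp_scale // invr_eq0.
apply/polyP => i; rewrite coefZ /quad !coefD coefXn coefCM coefX coefC.
case: i => [|[|[|i]]] /=; rewrite ?(mulr0, mulr1, addr0, add0r) 1?mulrC //.
  by rewrite (_ : d`_2 = lead_coef d) ?mulfV // lead_coefE sd.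
by rewrite (@nth_default _ 0 d) ?mul0r ?mulr0 ?sd.
Qed.

(** A reducible quintic has a factor of degree 1 or 2; by [radpE] such factors of p correspond to
    the nonzero elements of the radical. *)
Lemma quintic_irreducible : irreducible_poly p <-> (forall z, radp a z = 0 -> z = 0).
Proof.
split=> [[_ irr] z /radpE[//|rz|[z0 hz]]|rad0].
  have := irr ('X - z%:P); rewrite dvdp_XsubCl size_XsubC => /(_ isT rz)/eqp_size.
  by rewrite size_XsubC size_quintic.
- have := irr (quad z (c / z ^+ 3)); rewrite size_quad =>
  /(_ isT (pair_sum_quad_dvd z0 hz))/eqp_size.
  by rewrite size_quad size_quintic.
have no_root z : ~~ root p z.
  apply/negP => rz; have := root_neq0 rz; rewrite (rad0 z) ?eqxx //.
  by apply/radpE; constructor 2.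
have no2 (d : {poly F}) : d %| p -> size d != 2%N.
  move=> dp; apply/negP => /eqP/poly2_root[x rx].
  by have := root_dvdp dp rx; rewrite (negPf (no_root x)).
have no3 (d : {poly F}) : d %| p -> size d != 3%N.
  move=> dp; apply/negP => /eqP/quad_normalise[s [r /eqp_dvdl e]].
  move: dp; rewrite e => /quad_dvd_pair_sum[s0 hs _].
  by have := s0; rewrite (rad0 s) ?eqxx //; apply/radpE; constructor 3.
split=> [|d sd dp]; first by rewrite size_quintic.
have p0 : p != 0 by rewrite -size_poly_eq0 size_quintic.
have := dvdp_leq p0 dp; rewrite size_quintic leq_eqVlt => /orP[/eqP s6|lt6].
  by rewrite -(dvdp_size_eqp dp) s6 size_quintic.
have [e pe] := dvdpP _ _ dp; have ep : e %| p by rewrite pe dvdp_mulIl.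
have d0 : d != 0 by apply: contraTneq p0 => d0; rewrite pe d0 mulr0 eqxx.
have e0 : e != 0 by apply: contraTneq p0 => e0; rewrite pe e0 mul0r eqxx.
have := congr1 (fun p : {poly F} => size p) pe; rewrite size_quintic size_mul //.
move: (no2 _ dp) (no3 _ dp) (no2 _ ep) (no3 _ ep) sd lt6 d0 e0; rewrite -!size_poly_gt0.
move: (size d) (size e) => i j; clear; lia.
Qed.

(** Since q vanishes at roots of p, z comes from a quadratic factor, irreducible as q z = 1. The
    cubic cofactor has a root r, and the remaining quadratic has linear coefficient s = z + r. As q
    is additive on the radical, q s = 1, so this factor is irreducible too. *)
Lemma factorization_122_qform z : radp a z = 0 -> qform m a z = 1 ->
  factorization_type [:: (1, 1); (2, 2)]%N p.
Proof.
move=> rz qz; have [z0 hz] : z != 0 /\ pair_sum z.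
  case/radpE: (rz) => [z0|rtz|//]; first by move: qz; rewrite z0 (qform0 a cardF).
  by move: rtz qz; rewrite rootE horner_quintic => /eqP/(qform_root cardF m_even a_neq0) ->.
pose v := c / z ^+ 5; have tv : tr v = 1 by rewrite -(qform_pair_sum cardF a_neq0 z0 hz).
have [y hy] := cubic_root cardF m_gt0 m_even tv.
(* X = z (Y + 1) turns the cubic cofactor of p into z^3 (Y^3 + v Y + v). *)
pose r := z * (y + 1).
have z3 : z ^+ 3 != 0 by rewrite expf_neq0.
have vz : v * z ^+ 5 = c by rewrite /v divfK // expf_neq0.
have rt : root p r.
  have zv : z = z ^+ 5 * (v ^+ 2 + v + 1).
    have z5 : z ^+ 5 != 0 by rewrite expf_neq0.
    apply: (mulfI z5); rewrite -exprSr; apply: subr0_eq; rewrite (oppr2 cardF) -hz -vz;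
      ring: two0.
  rewrite rootE horner_quintic -vz /r {2}zv.
  transitivity (z ^+ 5 * (y ^+ 3 + v * y + v) * (y ^+ 2 + y + v) == 0).
    by congr (_ == _); ring: two0 four0 five1 six0 ten0.
  by rewrite hy mulr0 mul0r eqxx.
have rr : radp a r = 0 by apply/radpE; constructor 2.
have qr : qform m a r = 0.
  by apply: (qform_root cardF m_even a_neq0); rewrite -horner_quintic; apply/rootP.
have [k pk] := dvdpP _ _ (pair_sum_quad_dvd z0 hz).
have rk : root k r.
  have : root (quad z (c / z ^+ 3)) r = false.
    have irr : irreducible_poly (quad z (c / z ^+ 3)) by apply/quad_irreducible.
    apply/negP; rewrite -dvdp_XsubCl => d; case: irr => _ /(_ _ _ d)/eqp_size.
    by rewrite size_XsubC size_quad => /(_ isT).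
  by move: rt; rewrite pk rootM => /orP[//|->].
have [l kl] := dvdpP _ _ (etrans (dvdp_XsubCl k r) rk).
have p0 : p != 0 by rewrite -size_poly_eq0 size_quintic.
have l0 : l != 0 by apply: contraTneq p0 => l0; rewrite pk kl l0 !mul0r eqxx.
have sl : size l = 3%N.
  have := congr1 (fun p : {poly F} => size p) pk.
  have q0 : quad z (c / z ^+ 3) != 0 by rewrite -size_poly_eq0 size_quad.
  have X0 : 'X - r%:P != 0 by rewrite polyXsubC_eq0.
  rewrite size_quintic kl !size_mul ?mulf_neq0 // size_XsubC size_quad.
  by move: l0; rewrite -size_poly_gt0; move: (size l) => i; clear; lia.
have [s [t e]] := quad_normalise sl.
have lp : l %| p by rewrite pk kl -!mulrA dvdp_mulIl.
have := lp; rewrite (eqp_dvdl _ e) => /quad_dvd_pair_sum[s0 hs et].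
have sE : s = z + r.
  have [x x0 lx] : exists2 x, x != 0 & l = x *: quad s t.
    case/eqpP: e => [[x1 x2] /= /andP[x10 x20] h]; exists (x1^-1 * x2).
      by rewrite mulf_neq0 ?invr_eq0.
    by rewrite -scalerA -h scalerA mulVf // scale1r.
  (* T collects the terms of degree at most 3: the coefficients of X^5 and X^4 suffice, the latter
     being 0 in p. *)
  pose T : {poly F} := (c / z ^+ 3 + s * z + s * r + r * z + t)%:P * 'X^3
    + (s * (c / z ^+ 3) + r * (c / z ^+ 3) + t * z + s * r * z + t * r)%:P * 'X^2
    + (t * (c / z ^+ 3) + s * r * (c / z ^+ 3) + t * r * z)%:P * 'X + (t * r * (c / z ^+ 3))%:P.
  have pT : p = x *: ('X^5 + (s + z + r)%:P * 'X^4 + T).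
    rewrite pk kl lx -!scalerAl; congr (_ *: _); rewrite /T /quad.
    have -> : 'X - r%:P = 'X + r%:P by rewrite -polyCN (oppr2 cardF).
    move: (c / z ^+ 3) => rho; rewrite !(rmorphD, rmorphM) /=; ring: two0P.
  have coefT i : (3 < i)%N -> T`_i = 0.
    case: i => [|[|[|[|i]]]] // _.
    by rewrite /T !coefD !coefCM !coefXn coefX coefC /= !mulr0 !addr0.
  move: (T) coefT pT => {}T coefT pT.
  have x1 : x = 1.
    have := congr1 (fun p : {poly F} => p`_5) pT.
    rewrite /p coefZ !coefD coefCM !coefXn coefX coefC coefT //= !mulr0 !addr0 mulr1.
    by move=> <-.
  have := congr1 (fun p : {poly F} => p`_4) pT.
  rewrite /p x1 coefZ !coefD coefCM !coefXn coefX coefC coefT //= !addr0 add0r mulr1 mul1r.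
  move=> h; have {}h : s + z + r = 0 by rewrite -h.
  by rewrite -[LHS]addr0 -h; ring: two0.
have qs : qform m a s = 1.
  by rewrite sE (qform_rad_additive cardF) // qz qr addr0.
have irr u : u != 0 -> pair_sum u -> qform m a u
  = 1 -> irreducible_poly (quad u (c / u ^+ 3)).
  by move=> u0 hu qu; apply/quad_irreducible; rewrite
    // -(qform_pair_sum cardF a_neq0 u0 hu).
exists [:: 'X - r%:P; quad z (c / z ^+ 3); quad s (c / s ^+ 3)]; split.
- move=> d; rewrite !inE => /or3P[] /eqP ->; first exact: irredp_XsubC.
    exact: irr.
  exact: irr.
- rewrite !big_cons big_nil mulr1 pk kl -et.
  rewrite [X in _ %= X]mulrA [X in _ %= X]mulrC mulrA eqp_mul2r -?size_poly_eq0 ?size_quad //.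
  by rewrite eqp_mul2r ?polyXsubC_eq0.
by rewrite /= size_XsubC !size_quad.
Qed.

Lemma qform_factorization_122 : factorization_type [:: (1, 1); (2, 2)]%N p ->
  exists z, radp a z = 0 /\ qform m a z = 1.
Proof.
case=> qs [irr pq /perm_mem /(_ 2%N)]; rewrite /= !inE => /mapP[d dqs sd].
have dp : d %| p.
  by rewrite (eqp_dvdr _ pq) (perm_big _ (perm_to_rem dqs)) big_cons dvdp_mulIl.
have [s [r e]] : exists s r, d %= quad s r by apply: quad_normalise; move: sd;
  case: (size d) => [|n] //= <-.
have irq : irreducible_poly (quad s r).
  split=> [|f sf]; first by rewrite size_quad.
  rewrite -(eqp_dvdr _ e) => fd; apply: eqp_trans e.
  by case: (irr d dqs) => _; apply.
have := dp; rewrite (eqp_dvdl _ e) => /quad_dvd_pair_sum[s0 hs er].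
exists s; split; first by apply/radpE; constructor 3.
by rewrite (qform_pair_sum cardF a_neq0 s0 hs); apply/quad_irreducible; rewrite // -er.
Qed.

End Quintic.

(** * Symplectic bases and the Arf invariant *)

Lemma sum_F2 (V : nmodType) (G : 'F_2 -> V) : \sum_(s : 'F_2) G s = G 0 + G 1.
Proof.
rewrite (bigD1 0) // (bigD1 1) //= big1 ?addr0 // => s /andP[s0 s1].
by case: (F2P s) s0 s1 => ->.
Qed.

Section Symplectic.
Variables (F : finFieldType) (B : F -> F -> 'F_2) (q : F -> 'F_2) (d : nat).
Hypothesis cardF : #|F| = (2 ^ (d + d))%N.
Hypotheses (BDl : forall x y z, B (x + y) z = B x z + B y z)
  (BC : forall x y, B x y = B y x) (Bxx : forall x, B x x = 0).
Hypothesis B_nondeg : forall x, x != 0 -> exists y, B x y = 1.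
Hypotheses (q0 : q 0 = 0) (qD : forall x y, q (x + y) = q x + q y + B x y).

Let BDr x y z : B x (y + z) = B x y + B x z.
Proof. by rewrite BC BDl ![B _ x]BC. Qed.

Let B0l x : B 0 x = 0.
Proof. by have := BDl 0 0 x; rewrite addr0 => {1}->; rewrite addFF. Qed.

Let Bmul x (s : 'F_2) y : B (x *+ s) y = s * B x y.
Proof. by case: (F2P s) => -> /=; rewrite ?mulr0n ?mulr1n ?mul0r ?mul1r. Qed.

Let Bsuml I (r : seq I) (P : pred I) (x : I -> F) y :
  B (\sum_(i <- r | P i) x i) y = \sum_(i <- r | P i) B (x i) y.
Proof. by elim/big_rec2: _ => [|i u v _ <-]; rewrite ?B0l ?BDl. Qed.

Lemma q_orthogonal_sum (I : eqType) (r : seq I) (x : I -> F) :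
  uniq r -> (forall i j, i != j -> B (x i) (x j) = 0) ->
  q (\sum_(i <- r) x i) = \sum_(i <- r) q (x i).
Proof.
move=> + orth; elim: r => [|i r IH] /=; first by rewrite !big_nil.
case/andP=> ir ur; rewrite !big_cons qD IH // BC Bsuml [X in _ + X = _]big1_seq ?addr0 //.
by move=> j /= jr; apply: orth; apply: contraNneq ir => <-.
Qed.

Lemma q_hyperbolic_plane x y (s t : 'F_2) : B x y = 1 ->
  q (x *+ s + y *+ t) = s * q x + t * q y + s * t.
Proof.
move=> h; case: (F2P s) => ->; case: (F2P t) => -> /=;
  by rewrite ?mulr0n ?mulr1n ?qD ?q0 ?B0l ?[B _ 0]BC ?B0l ?h ?mul0r ?mul1r ?mulr0 ?addr0 ?add0r ?q0.
Qed.

Section Coordinates.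
Variable e : 'I_(d + d) -> F.
(** Coordinates are grouped by hyperbolic planes, so that a character sum over F becomes a product
    over the planes. *)
Definition plane_coord (u : {ffun 'I_d -> 'F_2 * 'F_2}) : F :=
  \sum_i (e (lshift d i) *+ (u i).1 + e (rshift d i) *+ (u i).2).

Definition pair_coord (c : {ffun 'I_(d + d) -> 'F_2}) : {ffun 'I_d -> 'F_2 * 'F_2} :=
  [ffun i => (c (lshift d i), c (rshift d i))].

Lemma plane_coordE c : plane_coord (pair_coord c) = \sum_(i < d + d) e i *+ c i.
Proof.
rewrite big_split_ord /= -big_split /=; apply: eq_bigr => i _.
by rewrite !ffunE.
Qed.

Lemma pair_coord_bij : bijective pair_coord.
Proof.
exists (fun u : {ffun 'I_d -> 'F_2 * 'F_2} => [ffun k : 'I_(d + d) =>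
  match split k return 'F_2 with inl i => (u i).1 | inr i => (u i).2 end]).
  by move=> c; apply/ffunP => k; rewrite ffunE; case: splitP => i ki; rewrite ffunE /=;
     congr (c _); apply/val_inj.
move=> u; apply/ffunP => i; rewrite !ffunE (unsplitK (inl i)) (unsplitK (inr i)).
by case: (u i).
Qed.

Lemma plane_coord_bij : F2_basis e -> bijective plane_coord.
Proof.
move=> be; apply: inj_card_bij; last first.
  by rewrite card_ffun card_prod card_Fp // card_ord cardF expnD -expnMn.
have [g gK hK] := pair_coord_bij.
move=> u v; rewrite -[u]hK -[v]hK !plane_coordE => h.
have [c [_ uniqc]] := be (\sum_(i < d + d) e i *+ g u i).
by rewrite -(uniqc (g u)) // -(uniqc (g v)).
Qed.
End Coordinates.

(** The sum factors over the orthogonal hyperbolic planes; a plane contributes -2 if q is 1 on both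
    basis vectors, and 2 otherwise. *)
Lemma sum_chi_symplectic (e : 'I_(d + d) -> F) : symplectic_basis B e ->
  \sum_(x : F) chi (q x) =
  (-1) ^+ #|[set i : 'I_d | (q (e (lshift d i)) == 1) && (q (e (rshift d i))
    == 1)]| * 2 ^+ d.
Proof.
case=> be orth hyp; rewrite (reindex (plane_coord e)); last first.
  exact/onW_bij/plane_coord_bij.
pose G i (st : 'F_2 * 'F_2) :=
  chi (st.1 * q (e (lshift d i)) + st.2 * q (e (rshift d i)) + st.1 * st.2).
transitivity (\prod_(i < d) \sum_(st : 'F_2 * 'F_2) G i st).
  rewrite bigA_distr_bigA /=; apply: eq_bigr => u _.
  rewrite /plane_coord q_orthogonal_sum ?index_enum_uniq //.
    rewrite (big_morph chi chiD chi0); apply: eq_bigr => i _.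
    by rewrite q_hyperbolic_plane.
  move=> i j ij.
  have ne (k l : 'I_d) : k != l -> (k : nat) != l %[mod d].
    by rewrite !modn_small.
  rewrite !(BDl, BDr, Bmul) ![B _ (_ *+ _)]BC !Bmul.
  have hij := ne _ _ ij; have hji : (j : nat) != i %[mod d] by rewrite eq_sym.
  rewrite !orth //= ?modnDl; [by rewrite !(mulr0, addr0) | exact: hji ..].
have GE i : \sum_(st : 'F_2 * 'F_2) G i st =
    (-1) ^+ ((q (e (lshift d i)) == 1) && (q (e (rshift d i)) == 1)) * 2.
  rewrite -(pair_bigA _ (fun s t => G i (s, t))) /= !sum_F2 /G /=.
  by case: (F2P (q (e (lshift d i)))) => ->; case: (F2P (q (e (rshift d i)))) => ->.
rewrite (eq_bigr _ (fun i _ => GE i)) big_split /= prodr_const card_ord; congr (_ * _).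
rewrite -prodr_const [RHS]big_mkcond; apply: eq_bigr => i _; rewrite inE.
by case: (_ && _).
Qed.

(** Symplectic Gram-Schmidt: by counting there is z outside the span of the first j pairs; then
    [proj z] is nonzero and orthogonal to them, and non-degeneracy provides its partner. *)
Lemma symplectic_family (j : nat) : (j <= d)%N -> exists e f : nat -> F,
  forall i k, (i < j)%N -> (k < j)%N ->
  [/\ B (e i) (e k) = 0, B (f i) (f k) = 0 & B (e i) (f k) = (i == k)%:R].
Proof.
elim: j => [|j IH] lj; first by exists (fun=> 0), (fun=> 0).
have [e [f ef]] := IH (ltnW lj).
pose proj z := z + \sum_(i < j) (e i *+ B z (f i) + f i *+ B z (e i)).
have proj_e z k : (k < j)%N -> B (proj z) (e k) = 0.
  move=> kj; rewrite BDl Bsuml (bigD1 (Ordinal kj)) //= BDl !Bmul.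
  have [-> _ _] := ef _ _ kj kj; have [_ _] := ef _ _ kj kj; rewrite BC eqxx => ->.
  rewrite mulr0 mulr1 add0r big1 ?addr0 ?addFF // => i ik; rewrite BDl !Bmul.
  have ik' : (k == i :> nat) = false by apply: contraNF ik => /eqP ki; apply/eqP/val_inj.
  have [-> _ _] := ef _ _ (ltn_ord i) kj; have [_ _] := ef _ _ kj (ltn_ord i).
  by rewrite BC ik' => ->; rewrite !mulr0 addr0.
have proj_f z k : (k < j)%N -> B (proj z) (f k) = 0.
  move=> kj; rewrite BDl Bsuml (bigD1 (Ordinal kj)) //= BDl !Bmul.
  have [_ -> ->] := ef _ _ kj kj; rewrite eqxx.
  rewrite mulr0 mulr1 addr0 big1 ?addr0 ?addFF // => i ik; rewrite BDl !Bmul.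
  have ik' : (i == k :> nat) = false by apply: contraNF ik => /eqP ki; apply/eqP/val_inj.
  by have [_ -> ->] := ef _ _ (ltn_ord i) kj; rewrite ik' !mulr0 addr0.
pose span (u : {ffun 'I_j -> 'F_2 * 'F_2}) :=
  \sum_(i < j) (e i *+ (u i).1 + f i *+ (u i).2).
have [z zS] : exists z, z \notin codom span.
  apply/existsP; rewrite -negb_forall; apply/negP => /forallP h.
  have : (#|F| <= #|codom span|)%N by apply/subset_leq_card/subsetP => z _; apply: h.
  rewrite leqNgt => /negP; apply; apply: leq_ltn_trans (leq_image_card _ _) _.
  rewrite card_ffun card_prod card_Fp // card_ord cardF addnn -mul2n expnM.
  by rewrite ltn_exp2l.
have x0 : proj z != 0.
  apply: contraNneq zS => /eqP; rewrite addr_eq0 (oppr2 cardF) => /eqP ->.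
  apply/codomP; exists [ffun i : 'I_j => (B z (f i), B z (e i))].
  by apply: eq_bigr => i _; rewrite ffunE.
have [y hy] := B_nondeg x0.
(* [proj y] differs from y by an element of the span, to which [proj z] is orthogonal. *)
have hpy : B (proj z) (proj y) = 1.
  rewrite [proj y]/proj BDr hy BC Bsuml big1 ?addr0 // => i _.
  by rewrite BDl !Bmul ![B _ (proj z)]BC proj_e // proj_f // !mulr0 addr0.
exists (fun i => if i == j then proj z else e i), (fun i => if i == j then proj y else f i).
move=> i k; rewrite !ltnS (leq_eqVlt i) (leq_eqVlt k) /=.
case: (eqVneq i j) => [->|ij] /=; case: (eqVneq k j) => [->|kj] //= lij lkj.
- by rewrite !(proj_e, proj_f).
- by rewrite ![B _ (proj _)]BC !(proj_e, proj_f) // (negPf ij).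
exact: ef.
Qed.

(** Pairing with the vectors f k and e k reads off the coordinates, so the d pairs are independent,
    hence a basis by cardinality. *)
Lemma symplectic_basis_exists : exists e : 'I_(d + d) -> F, symplectic_basis B e.
Proof.
have [e [f ef]] := symplectic_family (leqnn d).
pose E (k : 'I_(d + d)) := match split k with inl i => e i | inr i => f i end.
have El i : E (lshift d i) = e i by rewrite /E (unsplitK (inl i)).
have Er i : E (rshift d i) = f i by rewrite /E (unsplitK (inr i)).
have Bl u (k : 'I_d) : B (plane_coord E u) (f k) = (u k).1.
  rewrite /plane_coord Bsuml (bigD1 k) //= BDl !Bmul El Er.
  have [_ -> ->] := ef _ _ (ltn_ord k) (ltn_ord k); rewrite eqxx mulr1 mulr0 addr0.
  rewrite big1 ?addr0 // => i ik; rewrite BDl !Bmul El Er.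
  have [_ -> ->] := ef _ _ (ltn_ord i) (ltn_ord k).
  by rewrite (_ : (i == k :> nat) = false) ?mulr0 ?addr0 //; apply: negPf.
have Br u (k : 'I_d) : B (plane_coord E u) (e k) = (u k).2.
  rewrite /plane_coord Bsuml (bigD1 k) //= BDl !Bmul El Er.
  have [-> _ _] := ef _ _ (ltn_ord k) (ltn_ord k); have [_ _] :=
    ef _ _ (ltn_ord k) (ltn_ord k).
  rewrite BC eqxx => ->; rewrite mulr1 mulr0 add0r.
  rewrite big1 ?addr0 // => i ik; rewrite BDl !Bmul El Er.
  have [-> _ _] := ef _ _ (ltn_ord i) (ltn_ord k); have [_ _] :=
    ef _ _ (ltn_ord k) (ltn_ord i).
  by rewrite BC (_ : (k == i :> nat) = false) => [->|]; rewrite ?mulr0 ?addr0 // eq_sym;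
    apply: negPf.
have inj : injective (plane_coord E).
  by move=> u v uv; apply/ffunP => k;
    rewrite [u k]surjective_pairing [v k]surjective_pairing
    -!Bl -!Br uv.
have bij : bijective (fun c => plane_coord E (pair_coord c)).
  apply: inj_card_bij; last by rewrite card_ffun card_Fp // card_ord cardF.
  by apply: inj_comp; [exact: inj | exact: bij_inj pair_coord_bij].
exists E; split.
- move=> x; case: bij => g gK hK; exists (g x); split; first by rewrite -plane_coordE hK.
  by move=> c ->; rewrite -plane_coordE gK.
- move=> i j ij; rewrite /E; move: ij.
  case: splitP => i' ->; case: splitP => j' ->; rewrite ?modnDl !modn_small // => ij.
  + by case: (ef _ _ (ltn_ord i') (ltn_ord j')).
  + by case: (ef _ _ (ltn_ord i') (ltn_ord j')) => _ _ ->; rewrite (negPf ij).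
  + by rewrite BC; case: (ef _ _ (ltn_ord j') (ltn_ord i')) => _ _ ->;
    rewrite eq_sym (negPf ij).
  by case: (ef _ _ (ltn_ord i') (ltn_ord j')).
by move=> i; rewrite El Er; case: (ef _ _ (ltn_ord i) (ltn_ord i)) => _ _ ->; rewrite eqxx.
Qed.

End Symplectic.

(** * Sums over roots of unity *)

Section PowerSums.
Variable V : zmodType.

Lemma sum_periodic (s b : nat) (g : nat -> V) : (forall j, g (b + j)%N = g j) ->
  \sum_(j < s * b) g j = (\sum_(j < b) g j) *+ s.
Proof.
move=> per; elim: s => [|s IH]; first by rewrite mul0n big_ord0.
by rewrite mulSn big_split_ord /= (eq_bigr (fun j : 'I_(s * b) => g j)) ?IH -?mulrS.
Qed.

Lemma sum_unity_roots (F : finFieldType) (N : nat) (z : F) (h : F -> V) :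
  N.-primitive_root z -> \sum_(v : F | v ^+ N == 1) h v = \sum_(j < N) h (z ^+ j).
Proof.
move=> pz; rewrite (reindex_onto (fun j : 'I_N => z ^+ j)
  (fun v => odflt (Ordinal (prim_order_gt0 pz)) [pick j : 'I_N | z ^+ j == v])) /=.
  apply: eq_bigl => j; rewrite -exprM mulnC exprM (prim_expr_order pz) expr1n eqxx /=.
  case: pickP => [k|/(_ j)]; rewrite ?eqxx //= (eq_prim_root_expr pz) !modn_small //.
move=> v /eqP/(prim_rootP pz)[i ->]; case: pickP => [k /eqP //|/(_ i)]; by rewrite eqxx.
Qed.

(** v -> v^s maps the (s b)-th roots of unity onto the b-th ones, each value being taken s times. *)
Lemma sum_unity_roots_pow (F : finFieldType) (s b : nat) (z : F) (h : F -> V) :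
  (s * b)%N.-primitive_root z ->
  \sum_(v : F | v ^+ (s * b) == 1) h (v ^+ s) = (\sum_(v : F | v ^+ b == 1) h v) *+ s.
Proof.
move=> pz; have sb0 := prim_order_gt0 pz; have s0 : (0 < s)%N by move: sb0;
  rewrite muln_gt0 => /andP[].
have pzs : b.-primitive_root (z ^+ s).
  have := dvdn_prim_root pz (dvdn_mull s (dvdnn b)).
  by rewrite mulnK // ; move: sb0; rewrite muln_gt0 => /andP[].
rewrite (sum_unity_roots _ pz) (sum_unity_roots _ pzs).
rewrite -(@sum_periodic s b (fun j => h ((z ^+ s) ^+ j))).
  by apply: eq_bigr => j _; rewrite -!exprM mulnC.
by move=> j; rewrite exprD (prim_expr_order pzs) mul1r.
Qed.

End PowerSums.

(** * The multiplicative group of a finite field *)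

Section FiniteField.
Variable F : finFieldType.

Lemma expf_card_pred (x : F) : x != 0 -> x ^+ #|F|.-1 = 1.
Proof.
move=> x0; apply: (mulfI x0); rewrite -exprS prednK ?expf_card ?mulr1 //.
by apply/card_gt0P; exists 0.
Qed.

Lemma card_finField_gt1 : (1 < #|F|)%N. Proof. exact: finNzRing_gt1. Qed.

Lemma prim_root_exists : exists z : F, (#|F|.-1).-primitive_root z.
Proof.
have F1 := card_finField_gt1.
have h : has (#|F|.-1).-primitive_root [seq x <- enum F | x != 0].
  apply: has_prim_root.
  - by rewrite -ltnS prednK // ltnW.
  - by apply/allP => x; rewrite mem_filter => /andP[x0 _]; apply/unity_rootP/expf_card_pred.
  - exact: filter_uniq (enum_uniq _).
  have := count_predC (fun x : F => x == 0) (enum F).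
  have -> : count (fun x : F => x == 0) (enum F) = 1%N.
    by have := count_uniq_mem 0 (enum_uniq F); rewrite mem_enum.
  by rewrite -cardE size_filter => <-; rewrite add1n.
by case/hasP: h => z _ pz; exists z.
Qed.

Lemma neq0_unity (x : F) : (x != 0) = (x ^+ #|F|.-1 == 1).
Proof.
apply/idP/eqP => [/expf_card_pred //|e]; apply/eqP => x0; move: e.
rewrite x0 expr0n; have := card_finField_gt1; case: #|F| => [|[|k]] //= _ /eqP.
by rewrite eq_sym oner_eq0.
Qed.

(** A Bezout coefficient of i inverts the power map on nonzero elements; i != 0 ensures that only 0
    is sent to 0. *)
Lemma exprz_coprime_inj (i : int) : i != 0 -> coprimez i (#|F|.-1)%:Z ->
  injective (fun x : F => x ^ i).
Proof.
move=> i0 /coprimezP[[u v] /= uv] x y /= e.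
have powK (t : F) : t != 0 -> (t ^ i) ^ u = t.
  move=> t0; rewrite exprz_exp mulrC -[RHS]expr1z -uv expfzDr //.
  by rewrite [v * _]mulrC -(exprz_exp t _ v) -exprnP expf_card_pred // exp1rz mulr1.
have [x0|x0] := eqVneq x 0.
  move/eqP: e; rewrite x0 exp0rz (negPf i0) eq_sym expfz_eq0 i0 /=.
  by move/eqP ->.
have y0 : y != 0.
  by apply: contraNneq x0 => y0; move/eqP: e; rewrite y0 exp0rz (negPf i0) expfz_eq0 i0.
by rewrite -(powK x x0) e powK.
Qed.

End FiniteField.

(** * Bent functions constant on the lines of a quadratic extension *)

Section QuadraticExtension.
Variables (m : nat) (L K : finFieldType) (iota : {rmorphism K -> L}).
Hypotheses (m_gt0 : (0 < m)%N) (cardL : #|L| = (2 ^ (2 * m))%N) (cardK : #|K| = (2 ^ m)%N).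

Let q := (2 ^ m)%N.
Let q_gt1 : (1 < q)%N. Proof. by rewrite -(expn0 2) ltn_exp2l. Qed.
Let powq_iota (y : K) : iota y ^+ q = iota y.
Proof. by rewrite -rmorphXn expf_cardk. Qed.
Let powqq (x : L) : (x ^+ q) ^+ q = x.
Proof. by rewrite -exprM -expnD addnn -mul2n expf_cardk. Qed.

(** The q elements of the image of K already exhaust the roots of X^q - X. *)
Lemma fixed_in_subfield (z : L) : z ^+ q = z -> exists t, z = iota t.
Proof.
move=> zq; case: (boolP (z \in [seq iota t | t <- enum K])) => [/mapP[t _ ->]|zK].
  by exists t.
pose P : {poly L} := 'X^q - 'X.
have sP : size P = q.+1 by rewrite /P size_polyDl ?size_polyXn // size_polyN size_polyX.
have P0 : P != 0 by rewrite -size_poly_eq0 sP.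
have rP (x : L) : x ^+ q = x -> root P x.
  by move=> xq; rewrite rootE /P hornerD hornerN hornerXn hornerX xq subrr.
have aP : all (root P) (z :: [seq iota t | t <- enum K]).
  rewrite /= rP //=; apply/allP => _ /mapP[t _ ->]; exact: rP.
have uP : uniq (z :: [seq iota t | t <- enum K]).
  by rewrite /= zK map_inj_uniq ?enum_uniq //; exact: fmorph_inj.
by have := max_poly_roots P0 aP uP; rewrite sP /= size_map -cardE cardK ltnn.
Qed.

Definition reltr (z : L) : K := odflt 0 [pick t | iota t == z + z ^+ q].

Lemma reltrE z : iota (reltr z) = z + z ^+ q.
Proof.
rewrite /reltr; case: pickP => [t /eqP //|no].
have [|t e] := @fixed_in_subfield (z + z ^+ q); last by have := no t; rewrite e eqxx.
by rewrite (expD2X cardL) powqq addrC.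
Qed.

Lemma trace_tower (z : L) : trace2 (2 * m) z = trace2 m (reltr z).
Proof.
apply: (@natF2_inj L); rewrite (trE cardL).
rewrite -(rmorph_nat iota) (trE cardK) rmorph_sum /= mul2n -addnn big_split_ord /= -big_split /=.
apply: eq_bigr => i _; rewrite rmorphXn /= reltrE (expD2X cardL) -exprM.
by rewrite expnD mulnC.
Qed.

Lemma reltrM z y : reltr (z * iota y) = reltr z * y.
Proof.
apply: (fmorph_inj iota); rewrite rmorphM /= !reltrE exprMn powq_iota; ring.
Qed.

Lemma sum_chi_line (z : L) :
  \sum_(y : K) chi (trace2 (2 * m) (z * iota y)) = (q * (z ^+ q == z))%:Z.
Proof.
under eq_bigr => y _ do rewrite trace_tower reltrM.
rewrite (sum_chi_tr cardK m_gt0); congr (Posz (_ * nat_of_bool _)).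
by rewrite -(fmorph_eq0 iota) reltrE addr_eq0 (oppr2 cardL) eq_sym.
Qed.

Section Invariant.
Variable f : L -> 'F_2.
Hypotheses (f0 : f 0 = 0) (fK : forall y x, y != 0 -> f (iota y * x) = f x).

Let W (w : L) := \sum_(x : L) chi (f x + trace2 (2 * m) (w * x)).
Let M := \sum_(x : L | x != 0) chi (f x).

(** By invariance x may be replaced by iota y * x for every nonzero y, and the sum over y is given
    by [sum_chi_line]. The terms x = 0 and y = 0 account for the 1 subtracted from W w and for -
    M. *)
Lemma walsh_average (w : L) : (q%:Z - 1) * (W w - 1)
  = q%:Z * (\sum_(x : L | (x != 0) && ((w * x) ^+ q == w * x)) chi (f x)) - M.
Proof.
have W1 : W w - 1 = \sum_(x : L | x != 0) chi (f x) * chi (trace2 (2 * m) (w * x)).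
  rewrite /W (bigD1 0) //= f0 mulr0 (tr0 cardL) addr0 chi0 addrAC subrr add0r.
  by apply: eq_bigr => x _; rewrite chiD.
have shift (y : K) : y != 0 -> W w - 1
    = \sum_(x : L | x != 0) chi (f x) * chi (trace2 (2 * m) (w * x * iota y)).
  move=> y0; have iy : iota y != 0 by rewrite fmorph_eq0.
  rewrite W1 (reindex_inj (mulfI iy)) /=; apply: eq_big => x.
    by rewrite mulf_eq0 negb_or iy.
  by move=> _; rewrite fK // (mulrC (iota y)) mulrA.
have card0 : (\sum_(y : K | y != 0) 1 : int) = q%:Z - 1.
  rewrite sumr_const (eq_card (B := predC1 (0 : K))) // cardC1 cardK natz -/q.
  by have := q_gt1; lia.
rewrite -card0 mulr_suml (eq_bigr (fun y =>
  \sum_(x : L | x != 0) chi (f x) * chi (trace2 (2 * m) (w * x * iota y)))); last first.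
  by move=> y y0; rewrite mul1r (shift y).
rewrite exchange_big /= big_mkcondr /= mulr_sumr -sumrB; apply: eq_bigr => x x0.
rewrite -mulr_sumr; have := sum_chi_line (w * x);
  rewrite (bigD1 0) //= rmorph0 mulr0 (tr0 cardL) chi0.
move=> h; have -> : \sum_(y : K | y != 0) chi (trace2 (2 * m) (w * x * iota y))
  = (q * ((w * x) ^+ q == w * x))%:Z - 1.
  by rewrite -h addrAC subrr add0r.
by case: (_ == _); rewrite ?muln1 ?muln0 ?mulr0; ring.
Qed.

(** For w != 0 the nonzero x with w x in K lie on the line K w^-1, where f has the value f w^-1. So
    W w depends only on this value and on M, while W 0 = 1 + M. *)
Lemma bent_invariant : (2 < q)%N -> bent (2 * m) f <-> M = q%:Z - 1.
Proof.
move=> q3; have half : (2 * m)./2 = m by rewrite mul2n doubleK.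
have W0 : W 0 = 1 + M.
  rewrite /W (bigD1 0) //= f0 mulr0 (tr0 cardL) addr0 chi0; congr (_ + _).
  by apply: eq_bigr => x _; rewrite mul0r (tr0 cardL) addr0.
have Wn w : w != 0 -> (q%:Z - 1) * (W w - 1) = q%:Z * ((q%:Z - 1) * chi (f w^-1)) - M.
  move=> w0; rewrite walsh_average; congr (_ * _ - _).
  rewrite (eq_bigr (fun=> chi (f w^-1))); last first.
    move=> x /andP[x0 /eqP/fixed_in_subfield[t et]].
    have -> : x = iota t * w^-1 by rewrite -et mulrAC mulfV // mul1r.
    rewrite fK //; apply: contra_eq_neq et => ->; rewrite rmorph0 mulf_neq0 //.
  rewrite sumr_const -[LHS]mulr_natl; congr (_ * _).
  have -> : #|[pred x | (x != 0) && ((w * x) ^+ q == w * x)]|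
    = #|[set iota y / w | y : K in predC1 0]|.
    apply: eq_card => x; rewrite !inE; apply/andP/imsetP =>
      [[x0 /eqP/fixed_in_subfield[t et]]|[t t0 ->]].
      exists t; last by rewrite -et mulrAC mulfV // mul1r.
      by rewrite !inE; apply: contra_eq_neq et => ->; rewrite rmorph0 mulf_neq0.
    split; first by rewrite mulf_neq0 ?invr_eq0 // fmorph_eq0; rewrite !inE in t0.
    by rewrite mulrCA mulfV // mulr1 powq_iota.
  rewrite card_imset ?cardC1 ?cardK -/q; first by have := q_gt1; rewrite natz; lia.
  by move=> x y /(mulIf (invr_neq0 w0))/fmorph_inj.
have powZ : (2 ^+ m : int) = q%:Z by rewrite -natrX natz.
split=> [b|M1 w].
  have := b 0; rewrite half powZ /= -/(W 0) W0 => -[e|e]; first by lia.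
  (* The other possibility, W 0 = - q, is incompatible with W 1 = q and with W 1 = - q because q >
     2. *)
  have eM : M = - q%:Z - 1 by lia.
  have := Wn 1 (oner_neq0 _); rewrite eM.
  have := b 1; rewrite half powZ /= -/(W 1) => bw.
  have : chi (f 1^-1) = 1 \/ chi (f 1^-1) = -1 by case: (F2P (f 1^-1)) => ->;
    [left | right].
  by case=> ->; case: bw => ->; nia.
have [->|w0] := eqVneq w 0.
  by left; rewrite /= -/(W 0) W0 M1 half powZ; lia.
have := Wn w w0; rewrite M1 half powZ /= -/(W w).
have : chi (f w^-1) = 1 \/ chi (f w^-1) = -1 by case: (F2P (f w^-1)) => ->; [left | right].
move=> c e; have {}e : W w - 1 = q%:Z * chi (f w^-1) - 1.
  have q1 : q%:Z - 1 != 0 by lia.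
  by apply: (mulfI q1); rewrite e; ring.
by case: c => h; [left | right]; move: e; rewrite h; lia.
Qed.

End Invariant.

(** For i coprime to |L| - 1, the map x -> x^i permutes the nonzero elements of L and those of K, so
    it preserves both the invariance and the sum. *)
Lemma hyper_bent_invariant (f : L -> 'F_2) :
  (2 < q)%N -> f 0 = 0 -> (forall y x, y != 0 -> f (iota y * x) = f x) ->
  hyper_bent (2 * m) f <-> \sum_(x : L | x != 0) chi (f x) = q%:Z - 1.
Proof.
move=> q3 f0 fK; split=> [[/bent_invariant -> //]|M1].
split=> [|i cop]; first exact/bent_invariant.
have N2 : (2 < 2 ^ (2 * m))%N by rewrite mulnC expnM (leq_trans q3) // -/q; nia.
have cop' : coprimez i (#|L|.-1)%:Z.
  move: cop; congr (coprimez i _); rewrite cardL -[2 ^+ (2 * m)]/((2 : int) ^+ (2 * m)).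
  by rewrite -natrX natz; lia.
have i0 : i != 0.
  by apply: contraTneq cop' => ->; rewrite /coprimez gcd0z cardL; lia.
apply/bent_invariant => //.
- by rewrite exp0rz (negPf i0).
- by move=> y x y0; rewrite expfzMl -fmorphXz fK // expfz_neq0.
rewrite -M1 [RHS](reindex_inj (exprz_coprime_inj i0 cop')) /=.
by apply: eq_bigl => x; rewrite expfz_eq0 i0.
Qed.

End QuadraticExtension.

(** * The sum over U and the Kloosterman sum *)

Section ExponentialSum.
Variables (m : nat) (L K : finFieldType) (iota : {rmorphism K -> L}).
Hypotheses (m_gt0 : (0 < m)%N) (cardL : #|L| = (2 ^ (2 * m))%N) (cardK : #|K| = (2 ^ m)%N).
Variables (a : K) (beta : L).
Hypotheses (a_neq0 : a != 0) (five_dvd : (5 %| 2 ^ m + 1)%N).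
Hypotheses (betaE : beta ^+ 4 = beta + 1) (tr4_beta : trace2 4 beta = 0).

Let q := (2 ^ m)%N.
Let r := ((q + 1) %/ 5)%N.
Let two0 : 2%:R = 0 :> L. Proof. exact: card2_natr2 cardL. Qed.
Let m2_gt0 : (0 < 2 * m)%N. Proof. by rewrite muln_gt0. Qed.
Let q_gt1 : (1 < q)%N. Proof. by rewrite -(expn0 2) ltn_exp2l. Qed.
Let q1r : (q + 1 = 5 * r)%N. Proof. by rewrite /r mulnC divnK. Qed.
Let qq : (2 ^ (2 * m) = q * q)%N. Proof. by rewrite mul2n -addnn expnD. Qed.
Let N_def : ((2 ^ (2 * m)).-1 = (q.-1) * (q + 1))%N. Proof. by rewrite qq; have := q_gt1;
  nia. Qed.

Let g (z : L) := chi (trace2 4 (beta * z)).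

(* Tr(beta z) + Tr(beta / z) = z + z^2 + z^3 + z^4. *)
Lemma chi_tr4_sym (z : L) : z ^+ 5 = 1 -> g z + g z^-1 = 2 * (z == 1)%:R.
Proof.
move=> z5; have [->|z1] := eqVneq z 1.
  by rewrite /g invr1 mulr1 tr4_beta.
have z0 : z != 0 by apply: contra_eq_neq z5 => ->; rewrite expr0n eq_sym oner_eq0.
have zV : z^-1 = z ^+ 4 by apply: (mulfI z0); rewrite mulfV // -exprS.
have b16 : beta ^+ 16 = beta.
  by rewrite (exprM beta 4 4) betaE (expD2X cardL 2%N) expr1n betaE; ring: two0.
have z16 (x : L) : x ^+ 5 = 1 -> x ^+ 16 = x.
  by move=> x5; rewrite (exprD x 15 1) (exprM x 5 3) x5 expr1n mul1r.
have zV5 : z^-1 ^+ 5 = 1 by rewrite exprVn z5 invr1.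
have t4 (x : L) : x ^+ 5 = 1 ->
    (trace2 4 (beta * x) : nat)%:R = beta * x + beta ^+ 2 * x ^+ 2 + (beta + 1) * x ^+ 4
       + (beta ^+ 2 + 1) * x ^+ 3 :> L.
  move=> x5; rewrite -(@trace2E L 4 (beta * x)); last first.
  - by rewrite exprMn b16 z16.
  - exact: card2_pchar cardL.
  rewrite !big_ord_recl big_ord0 /= !exprMn (exprM beta 4 2) betaE (sqrD2 cardL) expr1n.
  have -> : x ^+ 8 = x ^+ 3 by rewrite (exprD x 5 3) x5 mul1r.
  by rewrite expr1 /bump /=; ring.
have S0 : 1 + z + z ^+ 2 + z ^+ 3 + z ^+ 4 = 0.
  apply: (mulfI (_ : z - 1 != 0)); first by rewrite subr_eq0.
  rewrite mulr0 (_ : _ * _ = z ^+ 5 - 1); first by rewrite z5 subrr.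
  by ring.
have : trace2 4 (beta * z) + trace2 4 (beta * z^-1) = 1.
  apply: (@natF2_inj L); rewrite (natF2D cardL) !t4 // zV.
  have -> : (z ^+ 4) ^+ 2 = z ^+ 3 by rewrite -exprM (exprD z 5 3) z5 mul1r.
  have -> : (z ^+ 4) ^+ 3 = z ^+ 2
    by rewrite -exprM (exprD z 10 2) (exprM z 5 2) z5 expr1n mul1r.
  have -> : (z ^+ 4) ^+ 4 = z by rewrite -exprM z16.
  transitivity (1 + (1 + z + z ^+ 2 + z ^+ 3 + z ^+ 4)); last by rewrite S0 addr0.
  by ring: two0.
rewrite /g; case: (F2P (trace2 4 (beta * z))) => ->; case: (F2P (trace2 4 (beta * z^-1)))
  => -> //.
Qed.

Let F (v : L) := trace2 (2 * m) (iota a * v) + trace2 4 (beta * v ^+ r).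

Let powq_iota (y : K) : iota y ^+ q = iota y.
Proof. by rewrite -rmorphXn expf_cardk. Qed.

(** On U the inverse is the conjugate v^q, and a is fixed by conjugation. *)
Lemma trU_inv (v : L) : v ^+ (q + 1) = 1 ->
  trace2 (2 * m) (iota a * v^-1) = trace2 (2 * m) (iota a * v).
Proof.
move=> vU; have v0 : v != 0.
  by apply: contra_eq_neq vU => ->; rewrite expr0n addn1 eq_sym oner_eq0.
have -> : v^-1 = v ^+ q by apply: (mulfI v0); rewrite mulfV // -exprS -addn1.
by rewrite -{1}powq_iota -exprMn (tr_exp2 cardL).
Qed.

(** x -> x^(q-1) maps the nonzero elements onto U with fibres of size q - 1, and (q^2 - 1)/5 = (q -
    1) r. *)
Lemma sum_fab :
  \sum_(x : L | x != 0) chi (fab m (2 * m) (iota a) beta x)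
  = (\sum_(v : L | v ^+ (q + 1) == 1) chi (F v)) *+ q.-1.
Proof.
have [z pz] := prim_root_exists L; move: pz; rewrite cardL N_def => pz.
rewrite -(sum_unity_roots_pow (fun v => chi (F v)) pz) -N_def -cardL.
apply: eq_big => x; first exact: neq0_unity.
move=> _; rewrite /fab /F -/q -subn1; congr (chi (_ + trace2 4 (beta * _))).
rewrite -exprM; congr (_ ^+ _); rewrite subn1 N_def q1r mulnCA mulKn //.
by rewrite subn1.
Qed.

Lemma sum_F : (\sum_(v : L | v ^+ (q + 1) == 1) chi (F v)) *+ 5
  = \sum_(v : L | v ^+ (q + 1) == 1) chi (trace2 (2 * m) (iota a * v ^+ 5)).
Proof.
have [z pz] := prim_root_exists L; move: pz; rewrite cardL N_def => pz.
have pzU : (5 * r).-primitive_root (z ^+ q.-1).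
  have q0 : (0 < q.-1)%N by have := q_gt1; lia.
  have := dvdn_prim_root pz (dvdn_mull q.-1 (dvdnn (q + 1))).
  by rewrite mulnK ?addn_gt0 ?orbT // q1r.
(* v -> v^5 is five-to-one from U onto the r-th roots of unity, the elements that survive the
   pairing of v with 1/v. *)
rewrite {2}q1r (sum_unity_roots_pow (fun v => chi (trace2 (2 * m) (iota a * v))) pzU).
congr (_ *+ 5).
set S := LHS; set X := RHS.
suff : S + S = 2 * X by move: (S) (X) => s x; clear; lia.
rewrite {2}/S (reindex_inj invr_inj) /=.
rewrite (eq_bigl (fun v : L => v ^+ (q + 1) == 1)); last by move=> v;
  rewrite exprVn invr_eq1.
rewrite /S /X -big_split /= mulr_sumr.
rewrite [RHS]big_mkcond [LHS]big_mkcond; apply: eq_bigr => v _.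
have [vU|vU] := eqVneq (v ^+ (q + 1)) 1; last first.
  by case: eqP => // vr; case/eqP: vU; rewrite q1r mulnC exprM vr expr1n.
rewrite /F !chiD trU_inv // -mulrDr exprVn chi_tr4_sym; last first.
  by rewrite -exprM mulnC -q1r.
by case: eqP => _; rewrite ?mulr1 ?mulr0 // mulrC.
Qed.

(* Each t in K has exactly two preimages under v + 1/v in the disjoint union
   of K^* and U. *)
Lemma card_preimages (t : K) :
  (#|[set v : L | (v ^+ (q + 1) == 1%R) && (reltr m iota v == t)]|
   + #|[set c : K | (c != 0%R) && (c + c^-1 == t)%R]| = 2)%N.
Proof.
have Uinv (v : L) : v ^+ (q + 1) = 1 -> v != 0 /\ v ^+ q = v^-1.
  move=> vU; have v0 : v != 0.
    by apply: contra_eq_neq vU => ->; rewrite expr0n addn1 eq_sym oner_eq0.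
  by split=> //; apply: (mulfI v0); rewrite mulfV // -exprS -addn1.
have relU (v : L) : v ^+ (q + 1) = 1 -> (reltr m iota v == t) = (v + v^-1 == iota t).
  by move=> /Uinv[_ e]; rewrite -(inj_eq (fmorph_inj iota))
    (reltrE iota m_gt0 cardL cardK) -/q e.
have sum_inv (R : finFieldType) k (cR : #|R| = (2 ^ k)%N) (x y : R) : x != 0 -> y != 0 ->
    x + x^-1 = y + y^-1 -> x = y \/ x = y^-1.
  move=> x0 y0 e; have t0 := card2_natr2 cR.
  have : (x - y) * (x - y^-1) = 0.
    have -> : (x - y) * (x - y^-1) = x * (x - (y + y^-1)) + y * y^-1 by ring.
    by rewrite -e mulfV // mulrBr mulrDr mulfV //; ring: t0.
  by move/eqP; rewrite mulf_eq0 !subr_eq0 => /orP[]/eqP; [left | right].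
have [t00|t0] := eqVneq t 0.
  rewrite t00; have e1 (R : finFieldType) k (cR : #|R|
    = (2 ^ k)%N) (x : R) : x != 0 -> x + x^-1 = 0 -> x = 1.
    move=> x0 e; have [] // := sum_inv R k cR x 1 x0 (oner_neq0 _); last by rewrite invr1.
    by rewrite e invr1 (addxx2 cR).
  have -> : [set v : L | (v ^+ (q + 1) == 1) && (reltr m iota v == 0)] = [set 1].
    apply/setP => v; rewrite !inE; apply/andP/eqP => [[/eqP vU]|->].
      have [v0 _] := Uinv v vU.
      by rewrite -t00 relU // t00 rmorph0 => /eqP; apply: e1 cardL _ v0.
    by rewrite expr1n -t00 relU ?expr1n // t00 rmorph0 invr1 (addxx2 cardL) eqxx.
  have -> : [set c : K | (c != 0) && (c + c^-1 == 0)] = [set 1].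
    apply/setP => c; rewrite !inE; apply/andP/eqP => [[c0 /eqP]|->];
      first exact: e1 cardK _ c0.
    by rewrite oner_eq0 invr1 (addxx2 cardK) eqxx.
  by rewrite !cards1.
have it0 : iota t != 0 by rewrite fmorph_eq0.
have ne_inv (v : L) : v + v^-1 = iota t -> v != v^-1.
  by move=> e; apply: contraNneq it0 => ev; rewrite -e -ev (addxx2 cardL).
(* Putting v = t z turns v^2 + t v = 1 into z^2 + z = t^-2, which is solvable in L because elements
   of K have trace 0 over L. *)
have [v [v0 hv]] : exists v : L, v != 0 /\ v + v^-1 = iota t.
  have tr0 : trace2 (2 * m) (iota (t^-1 ^+ 2)) = 0.
    rewrite (trace_tower iota m_gt0 cardL cardK) (_ : reltr _ _ _ = 0) ?(tr0 cardK) //.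
    apply: (fmorph_inj iota); rewrite (reltrE iota m_gt0 cardL cardK) rmorph0.
    by rewrite -/q powq_iota (addxx2 cardL).
  have /(hilbert90 cardL m2_gt0)[z hz] := tr0.
  have hv : (iota t * z) ^+ 2 + iota t * (iota t * z) = 1.
    have -> : (iota t * z) ^+ 2 + iota t * (iota t * z) = iota t ^+ 2 * (z ^+ 2 + z)
      by ring.
    by rewrite hz rmorphXn fmorphV -exprMn mulfV // expr1n.
  have v0 : iota t * z != 0.
    by apply: contra_eq_neq hv => ->; rewrite expr0n mulr0 add0r eq_sym oner_eq0.
  exists (iota t * z); split=> //; apply: (mulfI v0); rewrite mulrDr mulfV // -hv.
  by ring: two0.
have root_v (x : L) : x != 0 -> x + x^-1 = iota t -> x = v \/ x = v^-1.
  by move=> x0 e; apply: (sum_inv L _ cardL) => //; rewrite e hv.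
(* Conjugation either fixes the solutions v and 1/v, which then lie in K, or exchanges them, and
   then they lie in U. *)
have [vq|vq] := eqVneq (v ^+ q) v.
  have [c vc] := fixed_in_subfield iota m_gt0 cardK vq.
  have c0 : c != 0 by move: v0; rewrite vc fmorph_eq0.
  have hc : c + c^-1 = t by apply: (fmorph_inj iota); rewrite rmorphD fmorphV -vc.
  have -> : [set v : L | (v ^+ (q + 1) == 1) && (reltr m iota v == t)] = set0.
    apply/setP => x; rewrite !inE; apply/negP => /andP[/eqP xU]; rewrite relU // => /eqP hx.
    have [x0 xq] := Uinv x xU; have := ne_inv x hx; rewrite -xq.
    by case: (root_v x x0 hx) => ->; rewrite ?exprVn vq eqxx.
  have -> : [set c : K | (c != 0) && (c + c^-1 == t)] = [set c; c^-1].
    apply/setP => x; rewrite !inE; apply/andP/orP => [[x0 /eqP hx]|].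
      by case: (sum_inv K _ cardK x c) => // [|->|->]; rewrite ?hx ?hc ?eqxx; auto.
    by case=> /eqP ->; rewrite ?invr_eq0 ?invrK c0 1?[c^-1 + c]addrC hc eqxx.
  rewrite cards0 cards2 (_ : c != c^-1) //.
  by apply: contraNneq t0 => e; rewrite -hc -e (addxx2 cardK).
have vqV : v ^+ q = v^-1.
  have vq0 : v ^+ q != 0 by rewrite expf_neq0.
  case: (root_v _ vq0) => [|e|//]; last by rewrite e eqxx in vq.
  by rewrite -exprVn -(expD2X cardL) hv powq_iota.
have vU : v ^+ (q + 1) = 1 by rewrite addn1 exprS vqV mulfV.
have vVU : v^-1 ^+ (q + 1) = 1 by rewrite exprVn vU invr1.
have -> : [set v : L | (v ^+ (q + 1) == 1) && (reltr m iota v == t)] = [set v; v^-1].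
  apply/setP => x; rewrite !inE; apply/andP/orP => [[/eqP xU]|].
    rewrite relU // => /eqP hx; have [x0 _] := Uinv x xU.
    by case: (root_v x x0 hx) => ->; rewrite eqxx; auto.
  by case=> /eqP ->; rewrite relU ?vU ?vVU // ?invrK 1?[v^-1 + v]addrC hv !eqxx.
have -> : [set c : K | (c != 0) && (c + c^-1 == t)] = set0.
  apply/setP => c; rewrite !inE; apply/negP => /andP[c0 /eqP hc].
  have ic0 : iota c != 0 by rewrite fmorph_eq0.
  have := root_v (iota c) ic0; rewrite -fmorphV -rmorphD hc => /(_ erefl) h.
  move: vq; suff -> : v ^+ q = v by rewrite eqxx.
  case: h => e; first by rewrite -e powq_iota.
  by rewrite -[v]invrK -e exprVn powq_iota.
by rewrite cards0 cards2 (ne_inv v hv).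
Qed.

Lemma dickson5 (R : comNzRingType) (v w : R) : 2%:R = 0 :> R -> v * w = 1 ->
  v ^+ 5 + w ^+ 5 = (v + w) ^+ 5 + (v + w) ^+ 3 + (v + w).
Proof.
move=> t0 vw; have e2 : (v + w) ^+ 2 = v ^+ 2 + w ^+ 2 by ring: t0.
have e4 : (v + w) ^+ 4 = v ^+ 4 + w ^+ 4.
  by rewrite (exprM (v + w) 2 2 : (v + w) ^+ 4 = _) e2; ring: t0.
by rewrite (exprS (v + w) 4) (exprS (v + w) 2) e4 e2; ring: t0 vw.
Qed.

(** By [dickson5] the summands are chi (q t) at t = v + 1/v and t = c + 1/c, and [card_preimages]
    says that every t occurs exactly twice. *)
Lemma sum_U5_K5 :
  \sum_(v : L | v ^+ (q + 1) == 1) chi (trace2 (2 * m) (iota a * v ^+ 5))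
  + \sum_(c : K | c != 0) chi (trace2 m (a * (c ^+ 5 + c^-1 ^+ 5))) = 2 * qsum m a.
Proof.
rewrite (eq_bigr (fun v => chi (qform m a (reltr m iota v)))); last first.
  move=> v /eqP vU; rewrite (trace_tower iota m_gt0 cardL cardK) (qformE a cardK).
  congr (chi (trace2 _ _)); apply: (fmorph_inj iota).
  have v0 : v != 0 by apply: contra_eq_neq vU => ->; rewrite expr0n addn1 eq_sym oner_eq0.
  have vq : v ^+ q = v^-1 by apply: (mulfI v0); rewrite mulfV // -exprS -addn1.
  have vw : v * v^-1 = 1 by rewrite mulfV.
  have := dickson5 two0 vw.
  rewrite !(rmorphD, rmorphM, rmorphXn) /= !(reltrE iota m_gt0 cardL cardK) -/q exprMn powq_iota -exprM mulnC exprM vq.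
  by move=> e; rewrite -mulrDr e !mulrDr.
rewrite [X in _ + X](eq_bigr (fun c => chi (qform m a (c + c^-1)))); last first.
  move=> c c0; rewrite (qformE a cardK); congr (chi (trace2 _ _)).
  have cw : c * c^-1 = 1 by rewrite mulfV.
  by rewrite (dickson5 (card2_natr2 cardK) cw) !mulrDr.
rewrite (partition_big (reltr m iota) predT) //= [X in _ + X](partition_big (fun c =>
  c + c^-1) predT) //=.
rewrite -big_split /= /qsum mulr_sumr; apply: eq_bigr => t _.
rewrite (eq_bigr (fun=> chi (qform m a t))); last by move=> v /andP[_ /eqP ->].
rewrite [X in _ + X](eq_bigr (fun=> chi (qform m a t))); last by move=> v /andP[_ /eqP ->].
rewrite !sumr_const -mulrnDr [RHS]mulr_natl; congr (_ *+ _).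
by rewrite -(card_preimages t) !cardsE.
Qed.

(** As 5 divides q + 1 it does not divide q - 1, so c -> c^5 permutes the nonzero elements. Then c =
    x/a gives x + a^2/x, and a further squaring of x gives the square of x + a/x. *)
Lemma sum_K5 :
  \sum_(c : K | c != 0) chi (trace2 m (a * (c ^+ 5 + c^-1 ^+ 5))) = Kl m a.
Proof.
have cop : coprimez 5%:Z (#|K|.-1)%:Z.
  rewrite -[coprimez _ _]/(coprime 5 _) cardK prime_coprime //; apply/negP => h.
  have := dvdn_sub five_dvd h; rewrite -/q (_ : q + 1 - q.-1 = 2)%N //.
  by have := q_gt1; lia.
have i5 : injective (fun x : K => x ^+ 5).
  by have := @exprz_coprime_inj K 5%:Z isT cop.
have K5 : \sum_(c : K | c != 0) chi (trace2 m (a * (c ^+ 5 + c^-1 ^+ 5)))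
   = \sum_(c : K | c != 0) chi (trace2 m (a * (c + c^-1))).
  rewrite [RHS](reindex_inj i5) /=; apply: eq_big => c; first by rewrite expf_eq0.
  by move=> _; rewrite exprVn.
rewrite K5 (reindex_inj (mulfI (_ : a^-1 != 0))) ?invr_eq0 //=.
transitivity (\sum_(x : K | x != 0) chi (trace2 m (x + a ^+ 2 / x))).
  apply: eq_big => x; first by rewrite mulf_eq0 invr_eq0 negb_or a_neq0.
  move=> x0; congr (chi (trace2 _ _)).
  by rewrite invfM invrK mulrDr !mulrA mulfV // mul1r -expr2.
rewrite /Kl (reindex_inj (sqr_inj2 cardK)) /=; apply: eq_big => x; first
  by rewrite sqrf_eq0.
by move=> x0; rewrite -exprVn -exprMn -(sqrD2 cardK) (tr_sqr cardK).
Qed.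

Lemma Kloosterman_Kl : Kloosterman m a = 1 + Kl m a.
Proof.
rewrite /Kloosterman (bigD1 0) //= mulr0 invr0 addr0 (tr0 cardK) chi0; congr (_ + _).
rewrite /Kl (reindex_inj invr_inj) /=; apply: eq_big => x; first by rewrite invr_eq0.
by move=> x0; rewrite invrK addrC.
Qed.

(** With S the sum of chi (F v) over U, hyper-bentness means S = 1, while 5 S + Kl = 2 Q. *)
Lemma hyper_bent_Kloosterman : (2 < q)%N ->
  hyper_bent (2 * m) (fab m (2 * m) (iota a) beta) <-> Kloosterman m a = 2 * qsum m a - 4.
Proof.
move=> q3; have t40 : trace2 4 (0 : L) = 0.
  by rewrite /trace2 big1 ?eqxx // => i _; rewrite expr0n expn_eq0.
have e0 : (0 < (2 ^ (2 * m) - 1) %/ 5)%N.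
  by rewrite subn1 N_def q1r mulnCA mulKn // muln_gt0; move: q1r q3; clear;
    move: (q) r => i j; lia.
have f0 : fab m (2 * m) (iota a) beta 0 = 0.
  rewrite /fab !expr0n (gtn_eqF e0) subn_eq0 leqNgt q_gt1 !mulr0 t40 (tr0 cardL).
  by rewrite addr0.
have fK y x : y != 0 ->
    fab m (2 * m) (iota a) beta (iota y * x) = fab m (2 * m) (iota a) beta x.
  move=> y0; have e1 : iota y ^+ q.-1 = 1.
    by rewrite /q -cardK -rmorphXn expf_card_pred // rmorph1.
  rewrite /fab !exprMn [(2 ^ m - 1)%N]subn1 -/q e1 mul1r.
  by rewrite subn1 N_def q1r mulnCA mulKn // [in (iota y) ^+ _]exprM e1 expr1n mul1r.
apply: (iff_trans (hyper_bent_invariant m_gt0 cardL cardK q3 f0 fK)).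
rewrite sum_fab Kloosterman_Kl; have := sum_U5_K5; rewrite sum_K5 -sum_F -/q.
move: (\sum_(v | _) _) (Kl m a) (qsum m a) => S k Q e.
have -> : S *+ q.-1 = q.-1%:Z * S by rewrite -mulr_natl natz.
have qE : q%:Z - 1 = q.-1%:Z by move: q_gt1; clear; move: (q) => i; lia.
have q0 : q.-1%:Z != 0 by move: q_gt1; clear; move: (q) => i; lia.
rewrite qE; split=> [h|h].
  have S1 : S = 1 by apply: (mulfI q0); rewrite h mulr1.
  by move: S1 e; clear; lia.
by rewrite (_ : S = 1) ?mulr1 //; move: e h; clear; lia.
Qed.

End ExponentialSum.

(** * The criterion *)

Lemma five_dvd_4exp_odd (k : nat) : odd k -> (5 %| 2 ^ (2 * k) + 1)%N.
Proof.
move=> ok; rewrite expnM -(odd_double_half k) ok expnD -mul2n expnM.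
by rewrite /dvdn -modnDml -modnMmr -modnXm exp1n.
Qed.

Lemma trace2_rmorph (E F : fieldType) (iota : {rmorphism E -> F}) k (x : E) :
  trace2 k (iota x) = trace2 k x.
Proof.
rewrite /trace2 -(fmorph_eq0 iota) rmorph_sum /=.
by under [X in _ = if X == 0 then _ else _]eq_bigr => i _ do rewrite rmorphXn.
Qed.

(** The trace polynomial is x (x^3 + 1) (x^4 + x + 1), and an element of order 15 is not a root of
    the first two factors. *)
Lemma primitive_trace0 (F : finFieldType) (b : {unit F}) : #|F| = 16%N ->
  generator [set: {unit F}] b -> trace2 4 (val b) = 0 -> val b ^+ 4 = val b + 1.
Proof.
move=> cardF gen_b t0; have F4 : #|F| = (2 ^ 4)%N by rewrite cardF.
have two0 := card2_natr2 F4; set x := val b.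
have ord_b : #[b]%g = 15%N.
  by move: gen_b; rewrite /generator orderE => /eqP <-; rewrite card_finField_unit cardF.
have x3 : x ^+ 3 != 1.
  apply: contraTneq isT => e; have : (b ^+ 3 = 1)%g by apply: val_inj;
    rewrite FinRing.val_unitX /= e.
  by move/eqP; rewrite -order_dvdn ord_b.
have x0 : x != 0 by apply/negP => /eqP x0; have := valP b; rewrite -/x x0 unitr0.
have : x + x ^+ 2 + x ^+ 4 + x ^+ 8 = 0.
  have := trE F4 x; rewrite t0 !big_ord_recl big_ord0 addr0 /= expr1 /bump /= => e.
  by rewrite -!addrA.
have -> : x + x ^+ 2 + x ^+ 4 + x ^+ 8 = x * (x ^+ 3 + 1) * (x ^+ 4 + x + 1).
  by ring: two0.
move/eqP; rewrite !mulf_eq0 addr_eq0 (oppr2 F4) (negPf x0) (negPf x3) /= => /eqP e.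
by apply/eqP; rewrite -subr_eq0 (oppr2 F4) addrA e.
Qed.

Section Criterion.
Variables (m1 : nat) (K : finFieldType) (a : K).
Hypotheses (m1_ge3 : (3 <= m1)%N) (cardK : #|K| = (2 ^ (2 * m1))%N) (a_neq0 : a != 0).

Let m := (2 * m1)%N.
Let s := (2 ^ m1)%N.
Let m_gt0 : (0 < m)%N. Proof. by rewrite /m; lia. Qed.
Let m_even : ~~ odd m. Proof. by rewrite /m oddM. Qed.
Let s_ge8 : (8 <= s)%N. Proof. exact: (leq_pexp2l (isT : 0 < 2)%N m1_ge3). Qed.
Let q_sqr : (2 ^ m = s * s)%N. Proof. by rewrite /m mul2n -addnn expnD. Qed.
Let s_int : (2 ^+ m1 : int) = s%:Z. Proof. by rewrite -natrX natz. Qed.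

(** At n = s the quadratics of [quad_ge0] take the values 2 s^2 - s Kl and 2 s^2 + s Kl. *)
Lemma Kloosterman_bound : - (2 * s%:Z) <= Kl m a /\ Kl m a <= 2 * s%:Z.
Proof.
have := quad_ge0 cardK m_gt0 a_neq0 false s; have := quad_ge0 cardK m_gt0 a_neq0 true s.
rewrite expr0 expr1 q_sqr PoszM; move: (Kl m a) s_ge8; move: (s) => x k; clear; nia.
Qed.

Lemma sform_nondeg (x : K) : (forall z, radp a z = 0 -> z = 0) -> x != 0 ->
  exists y, sform m a x y = 1.
Proof.
move=> rad0 x0; have rx : radp a x != 0 by apply: contraNneq x0 => /rad0 ->.
have [t tt] := tr_surj cardK m_gt0.
have [u eu] := sqr_surj2 cardK (t / radp a x); have [v ev] := sqr_surj2 cardK u.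
exists v; rewrite sformC (sformE _ cardK) (_ : v ^+ 4 = t / radp a x) ?divfK //.
by rewrite eu ev -exprM.
Qed.

Lemma qsum_symplectic (e : 'I_(m1 + m1) -> K) : symplectic_basis (sform m a) e ->
  qsum m a = (-1) ^+ #|[set i : 'I_m1 | (qform m a (e (lshift m1 i)) == 1)
                              && (qform m a (e (rshift m1 i)) == 1)]| * s%:Z.
Proof.
move=> be; rewrite -s_int; apply: sum_chi_symplectic be.
- by rewrite cardK mul2n -addnn.
- exact: sformDl cardK.
- exact: sformC.
- exact: (qform0 _ cardK).
exact: qformD cardK.
Qed.

Lemma Kloosterman_qsum_criterion :
  Kloosterman m a = 2 * qsum m a - 4 <->
  (factorization_type [:: (1, 1); (2, 2)]%N ('X^5 + 'X + (a^-1)%:P)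
     /\ Kloosterman m a = - 4)
  \/ [/\ irreducible_poly ('X^5 + 'X + (a^-1)%:P),
         even_form (sform m a) (qform m a) m1
       & Kloosterman m a = 2 * 2 ^+ m1 - 4].
Proof.
split=> [h|[[ft ->]|[irr [e [be ev]] ->]]]; last 2 first.
- have [z [rz qz]] := qform_factorization_122 cardK m_gt0 a_neq0 ft.
  by rewrite (qsum_eq0 cardK m_gt0 rz qz).
- by rewrite (qsum_symplectic be) -signr_odd (negPf ev) expr0 mul1r s_int.
case: (boolP [exists z, (radp a z == 0) && (qform m a z == 1)]) => [/existsP[z]|no].
  case/andP=> /eqP rz /eqP qz; left; split.
    exact: factorization_122_qform rz qz.
  by rewrite h (qsum_eq0 cardK m_gt0 rz qz).
have q0 z : radp a z = 0 -> qform m a z = 0.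
  move=> rz; case: (F2P (qform m a z)) => // qz.
  by case/existsP: no; exists z; rewrite rz qz !eqxx.
have := qsum_sqr_card cardK m_gt0 q0.
have r0 : radp a 0 = 0 by rewrite /radp !expr0n !mulr0 !addr0.
have : (0 < #|[set z | radp a z == 0%R]|)%N by apply/card_gt0P; exists 0; rewrite inE r0.
have [k1 k2] := Kloosterman_bound.
have hk : 1 + Kl m a = 2 * qsum m a - 4 by rewrite -(Kloosterman_Kl cardK).
move=> rad_gt0; rewrite q_sqr PoszM => Q2.
(* Let R be the order of the radical, so Q^2 = s^2 R. The bound on Kl = 2 Q - 5 and s >= 8 exclude R
   >= 2, and Q = - s when R = 1. *)
have [rad1 Qs] : #|[set z | radp a z == 0%R]| = 1%N /\ qsum m a = s%:Z.
  move: rad_gt0 Q2 k1 k2 hk s_ge8; move: #|_| (s) (Kl m a) (qsum m a) => R x k Q; clear.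
  move=> R0 Q2 k1 k2 hk x8.
  have R1 : R = 1%N by case: R R0 Q2 => [|[|R]] // _ Q2; nia.
  by split=> //; move: Q2; rewrite R1 mulr1 => Q2; nia.
right; have rad0 z : radp a z = 0 -> z = 0.
  move=> rz; have /eqP/cards1P[t et] := rad1.
  have : z \in [set t] by rewrite -et inE rz.
  have : 0 \in [set t] by rewrite -et inE r0.
  by rewrite !inE => /eqP -> /eqP.
split; first exact/(quintic_irreducible cardK a_neq0).
  have [|||||e be] := @symplectic_basis_exists K (sform m a) m1.
  - by rewrite cardK mul2n -addnn.
  - exact: sformDl cardK.
  - exact: sformC.
  - exact: (sform_xx _ cardK).
  - by move=> x; apply: sform_nondeg.
  exists e; split=> //; apply/negP => od.
  by have := qsum_symplectic be; rewrite Qs -signr_odd od expr1 mulN1r; move: s_ge8;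
    clear; lia.
by rewrite h Qs s_int.
Qed.

End Criterion.

Theorem theorem3 (n m m1 : nat)
    (n_def : n = (2 * m)%N) (m_def : m = (2 * m1)%N)
    (m1_odd : m1 = 1 %[mod 2]) (m1_ge3 : (3 <= m1)%N)
    (L K F16 : finFieldType)
    (cardL : #|L| = (2 ^ n)%N) (cardK : #|K| = (2 ^ m)%N) (cardF16 : #|F16| = 16%N)
    (iota : {rmorphism K -> L}) (iota16 : {rmorphism F16 -> L})
    (a : K) (a_neq0 : a != 0)
    (b : {unit F16}) (b_prim : generator [set: {unit F16}] b)
    (b_tr0 : trace2 4 (val b) = 0) :
  hyper_bent n (fab m n (iota a) (iota16 (val b))) <->
  (factorization_type [:: (1, 1); (2, 2)]%N ('X^5 + 'X + (a^-1)%:P)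
     /\ Kloosterman m a = - 4)
  \/ [/\ irreducible_poly ('X^5 + 'X + (a^-1)%:P),
         even_form (sform m a) (qform m a) m1
       & Kloosterman m a = 2 * 2 ^+ m1 - 4].
Proof.
subst n m; have m1o : odd m1 by move: m1_odd; rewrite modn2; case: (odd m1).
have m_gt0 : (0 < 2 * m1)%N by lia.
have q3 : (2 < 2 ^ (2 * m1))%N by rewrite (@leq_trans (2 ^ 2)%N) // leq_exp2l //; lia.
apply: iff_trans (Kloosterman_qsum_criterion m1_ge3 cardK a_neq0).
apply: hyper_bent_Kloosterman => //.
- exact: five_dvd_4exp_odd.
- by rewrite -rmorphXn (primitive_trace0 cardF16 b_prim b_tr0) rmorphD rmorph1.
by rewrite trace2_rmorph.
Qed.
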